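(* Let $\mathbf{x}$ be a closed equi-centro-affine extremal curve on the unit sphere $\mathbb{S}^2(1)$. Then one of the following holds: (1) $\mathbf{x}$ is a planar circle of radius $\sqrt6/3$; (2) $\mathbf{x}=\mathbf{x}_{p,q}$ has rotation index $p$ and closes up in $q$ periods of its (nonconstant periodic) curvature function, where the pair of positive integers $(p,q)$ is not arbitrary and must satisfy $\frac pq\in\left(\frac12,\frac{\sqrt2}{2}\right)$.
   Context: A smooth curve on $\mathbb{S}^2(1)\subset\mathbb{R}^3$ with nowhere vanishing geodesic curvature, oriented so that $\kappa_g>0$, with Euclidean arc length parameter $s$, is called equi-centro-affine extremal if $B=\kappa_g^{-2/3}$ satisfies $B_{ss}-2B^{-2}+B=0$ (the Euler-Lagrange equation of $\int\kappa_g^{1/3}ds$). If $B$ is nonconstant, then $B$ is periodic in $s$ and the vector field $\mathbf{J}=-2B^{-1/2}\mathbf{T}+B_s\boldsymbol\epsilon$ along the curve ($\mathbf{T}$ the unit tangent, $\boldsymbol\epsilon$ the unit normal in the sphere with $\nabla_{\mathbf T}\mathbf T=\kappa_g\boldsymbol\epsilon$) is the restriction of a Killing field of the sphere, i.e. of an infinitesimal rotation about an axis. The progression angle $\Lambda^\Theta$ is the absolute value of the change of the azimuthal angle about this axis along the curve over one period of $\kappa_g$. The curve closes up in $q$ periods with rotation index $p$ if $q\Lambda^\Theta=2\pi p$, i.e. it winds $p$ times around the axis during $q$ periods of the curvature; here $p,q$ are coprime positive integers. *)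

(* Defs.v *)
From Stdlib Require Export Reals.
From Coquelicot Require Export Coquelicot.

Open Scope R_scope.

Definition R3 : Type := (R * R * R)%type.

Definition c1 (v : R3) : R := fst (fst v).
Definition c2 (v : R3) : R := snd (fst v).
Definition c3 (v : R3) : R := snd v.

Definition dot (u v : R3) : R := c1 u * c1 v + c2 u * c2 v + c3 u * c3 v.

Definition enorm (v : R3) : R := sqrt (dot v v).

Definition vadd (u v : R3) : R3 := (c1 u + c1 v, c2 u + c2 v, c3 u + c3 v).

Definition vscal (a : R) (v : R3) : R3 := (a * c1 v, a * c2 v, a * c3 v).

Definition vsub (u v : R3) : R3 := (c1 u - c1 v, c2 u - c2 v, c3 u - c3 v).

Definition cross (u v : R3) : R3 :=
  (c2 u * c3 v - c3 u * c2 v,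
   c3 u * c1 v - c1 u * c3 v,
   c1 u * c2 v - c2 u * c1 v).

Definition vDerive (f : R -> R3) (s : R) : R3 :=
  (Derive (fun t => c1 (f t)) s,
   Derive (fun t => c2 (f t)) s,
   Derive (fun t => c3 (f t)) s).

Definition vsmooth (f : R -> R3) : Prop :=
  forall (n : nat) (s : R),
    ex_derive_n (fun t => c1 (f t)) n s /\
    ex_derive_n (fun t => c2 (f t)) n s /\
    ex_derive_n (fun t => c3 (f t)) n s.

Definition tangent (x : R -> R3) (s : R) : R3 := vDerive x s.

(* The unit normal in the sphere is the one for which (x, T, eps) is positively
   oriented; the opposite choice amounts to reversing the curve. *)
Definition conormal (x : R -> R3) (s : R) : R3 := cross (x s) (tangent x s).

(* Levi-Civita derivative of the tangent: the component of T' tangent to the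
   sphere. *)
Definition cov_tangent (x : R -> R3) (s : R) : R3 :=
  vsub (vDerive (tangent x) s)
       (vscal (dot (vDerive (tangent x) s) (x s)) (x s)).

Definition geod_curv (x : R -> R3) (s : R) : R :=
  dot (cov_tangent x s) (conormal x s).

Definition unit_speed_spherical (x : R -> R3) : Prop :=
  vsmooth x /\
  (forall s : R, enorm (x s) = 1) /\
  (forall s : R, enorm (tangent x s) = 1).

Definition Bfun (x : R -> R3) (s : R) : R := Rpower (geod_curv x s) (- (2 / 3)).

Definition eca_extremal (x : R -> R3) : Prop :=
  unit_speed_spherical x /\
  (forall s : R, 0 < geod_curv x s) /\
  (forall s : R, Derive_n (Bfun x) 2 s - 2 * / (Bfun x s) ^ 2 + Bfun x s = 0).

Definition closed_curve (x : R -> R3) : Prop :=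
  exists L : R, 0 < L /\ forall s : R, x (s + L) = x s.

Definition planar_circle (x : R -> R3) (r : R) : Prop :=
  exists c n : R3, enorm n = 1 /\
    forall y : R3,
      (exists s : R, x s = y) <->
      dot n (vsub y c) = 0 /\ enorm (vsub y c) = r.

Definition constant_fun (f : R -> R) : Prop := exists c : R, forall s : R, f s = c.

Definition least_period (f : R -> R) (P : R) : Prop :=
  0 < P /\
  (forall s : R, f (s + P) = f s) /\
  (forall P' : R, 0 < P' -> (forall s : R, f (s + P') = f s) -> P <= P').

Definition Jfield (x : R -> R3) (s : R) : R3 :=
  vadd (vscal (- 2 * Rpower (Bfun x s) (- (1 / 2))) (tangent x s))
       (vscal (Derive (Bfun x) s) (conormal x s)).

(* The Killing fields of the sphere are y |-> w x y; for w <> 0 this is an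
   infinitesimal rotation about the axis R w. *)
Definition killing (w y : R3) : R3 := cross w y.

(* th is a continuous azimuthal angle of the curve about the axis R w: in a
   positively oriented orthonormal frame (e1, e2, w/|w|), the projection of x
   to the plane of e1, e2 has polar coordinates (r, th), with r > 0. *)
Definition azimuth (w : R3) (x : R -> R3) (th : R -> R) : Prop :=
  (forall s : R, continuous th s) /\
  exists (e1 e2 : R3) (r : R -> R),
    enorm e1 = 1 /\ enorm e2 = 1 /\ dot e1 e2 = 0 /\
    w = vscal (enorm w) (cross e1 e2) /\
    forall s : R,
      0 < r s /\
      dot (x s) e1 = r s * cos (th s) /\
      dot (x s) e2 = r s * sin (th s).

(* Lam is determined by x and P: the axis is unique, because J determines w
   along a curve that is not contained in a line, and two continuous azimuths
   differ by a constant. *)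
Definition progression_angle (x : R -> R3) (P Lam : R) : Prop :=
  exists (w : R3) (th : R -> R),
    enorm w <> 0 /\
    (forall s : R, Jfield x s = killing w (x s)) /\
    azimuth w x th /\
    (forall s : R, Lam = Rabs (th (s + P) - th s)).

(* The curve winds p times around the axis of J while its curvature runs
   through q periods, after which the curve closes up. *)
Definition closes_up (x : R -> R3) (p q : nat) : Prop :=
  exists P Lam : R,
    least_period (geod_curv x) P /\
    progression_angle x P Lam /\
    INR q * Lam = 2 * PI * INR p /\
    (forall s : R, x (s + INR q * P) = x s).

(* Main.v *)
(* Write kappa = rho^-3, so that B = rho^2, and b = B'. The Euler-Lagrange
   equation has the first integral K^2 = b^2 + B^2 + 4 / B, and it makes the
   vector w = - B x - b T - (2 / rho) eps constant; w has length K and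
   J = w x x. Hence the height of the curve along the axis is - B / K, and the
   azimuth about w has angular velocity - 2 K / (rho (K^2 - B^2)).

   If B is constant, then B^3 = 2 and the height is - 1 / sqrt 3, a circle of
   radius sqrt (2/3).

   Otherwise, adding the derivative of the periodic function atan (b rho / 2)
   turns the angular velocity (up to sign) into rho^-3 (1 + 2 X) with
   X = B / (B + K). Let - sg be the negative root of K^2 t - t^3 - 4. Then
   1 / B = m + a cos phi, where phi' = 2 rho^-3 tau, tau^2 = 1 + B / sg, and phi
   gains 2 pi over one period, so the progression angle is pi times the
   phi-average of h = (1 + 2 X) / tau. Pointwise h > 1, which is the lower bound.
   For the upper bound, tau^2 (1 - X) = 1 - mu^2 X with mu^2 = 1 - K / sg, and mu
   is also the phi-average of X; h is a concave function of X, so by Jensen its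
   average is at most (1 + 2 mu) / sqrt (1 + mu + mu^2), and this is less than
   sqrt 2 because sg^3 > 16 for nonconstant B. Jensen's inequality is used in
   its tangent-line form, where the zero-average function X - mu is, up to a
   factor, the phi-derivative of an explicit periodic function. *)
Require Import Defs.
From Stdlib Require Import Reals Lra Lia Psatz ZArith Classical.
From Coquelicot Require Import Coquelicot.
(* Again, because Reals also defines a [c1]. *)
Require Import Defs.

(** * Angles and periods *)

Ltac split_all := repeat match goal with |- _ /\ _ => split | |- True => exact I end.

(* [split] and [eexists; apply] would unfold the [ex_derive] side conditions
   of [auto_derive], hence the syntactic matching. *)
Ltac derive_side :=
  split_all;
  try match goal with
  | H : forall s, is_derive ?f s _ |- ex_derive (fun t => ?f t) ?s =>
      exact (ex_intro _ _ (H s))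
  | H : forall s, is_derive ?f s _ |- ex_derive ?f ?s =>
      exact (ex_intro _ _ (H s))
  end.

Ltac derive_values :=
  repeat match goal with
  | H : forall s, is_derive ?f s _ |- context [Derive (fun t => ?f t) ?s] =>
      replace (Derive (fun t => f t) s) with (Derive f s) by reflexivity;
      rewrite (is_derive_unique f s _ (H s))
  end.

Lemma is_derive_value (f : R -> R) (s l l' : R) :
  is_derive f s l -> l = l' -> is_derive f s l'.
Proof. intros H <-; exact H. Qed.

Lemma incr_of_derive_pos (f f' : R -> R) :
  (forall s, is_derive f s (f' s)) -> (forall s, 0 < f' s) ->
  forall s t, s < t -> f s < f t.
Proof.
  intros Hd Hp s t Hst.
  destruct (MVT_cor2 f f' s t Hst) as [c [Hc _]].
  { intros c _; apply is_derive_Reals, Hd. }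
  specialize (Hp c); nra.
Qed.

Lemma nondecr_of_derive_nonneg (f f' : R -> R) :
  (forall s, is_derive f s (f' s)) -> (forall s, 0 <= f' s) ->
  forall s t, s < t -> f s <= f t.
Proof.
  intros Hd Hp s t Hst.
  destruct (MVT_cor2 f f' s t Hst) as [c [Hc _]].
  { intros c _; apply is_derive_Reals, Hd. }
  specialize (Hp c); nra.
Qed.

Lemma const_of_derive_0 (f : R -> R) :
  (forall s, is_derive f s 0) -> forall s t, f s = f t.
Proof.
  intros Hd.
  assert (W : forall s t, s < t -> f s = f t).
  { intros s t Hst.
    destruct (MVT_cor2 f (fun _ => 0) s t Hst) as [c [Hc _]].
    { intros c _; apply is_derive_Reals, Hd. }
    lra. }
  intros s t; destruct (Rtotal_order s t) as [H|[->|H]]; auto.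
  symmetry; auto.
Qed.

Lemma same_derive_diff (f g f' : R -> R) :
  (forall s, is_derive f s (f' s)) -> (forall s, is_derive g s (f' s)) ->
  forall s t, f s - g s = f t - g t.
Proof.
  intros Hf Hg.
  apply (const_of_derive_0 (fun s => f s - g s)); intros s.
  eapply is_derive_value.
  - apply @is_derive_minus; [apply Hf | apply Hg].
  - unfold minus, plus, opp; simpl; ring.
Qed.

Lemma is_derive_shift (f : R -> R) (P s l : R) :
  is_derive f (s + P) l -> is_derive (fun t => f (t + P)) s l.
Proof.
  intros H; eapply is_derive_value.
  - apply (is_derive_comp f (fun t => t + P)); [exact H|].
    auto_derive; trivial.
  - unfold scal; simpl; unfold mult; simpl; ring.
Qed.

Lemma polar_angle (u v : R) :
  u * u + v * v = 1 -> exists t, u = cos t /\ v = sin t.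
Proof.
  intros H.
  assert (Hu : -1 <= u <= 1) by nra.
  assert (Hs : sin (acos u) = sqrt (v * v)).
  { rewrite sin_acos by exact Hu. f_equal; unfold Rsqr; lra. }
  destruct (Rle_dec 0 v) as [Hv|Hv].
  - exists (acos u); rewrite cos_acos, Hs by exact Hu.
    split; [reflexivity | rewrite sqrt_square; lra].
  - exists (- acos u); rewrite cos_neg, sin_neg, cos_acos, Hs by exact Hu.
    split; [reflexivity |].
    replace (v * v) with ((-v) * (-v)) by ring.
    rewrite sqrt_square; lra.
Qed.

Lemma is_derive_primitive (f : R -> R) :
  (forall s, continuous f s) ->
  forall s, is_derive (fun t => RInt f 0 t) s (f s).
Proof.
  intros Hc s.
  apply (is_derive_RInt f (fun t => RInt f 0 t) 0).
  - apply filter_forall; intros t.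
    apply (RInt_correct f), ex_RInt_continuous; intros; apply Hc.
  - apply Hc.
Qed.

(* The increment of the angle is the integral of [f]; the rotated curve
   [(y1, y2) / r * exp (- i th)] has zero derivative. *)
Lemma angle_lift (y1 y2 d1 d2 f : R -> R) :
  (forall s, is_derive y1 s (d1 s)) -> (forall s, is_derive y2 s (d2 s)) ->
  (forall s, continuous f s) ->
  (forall s, 0 < y1 s * y1 s + y2 s * y2 s) ->
  (forall s, f s * (y1 s * y1 s + y2 s * y2 s) = y1 s * d2 s - y2 s * d1 s) ->
  exists th : R -> R, (forall s, is_derive th s (f s)) /\
    forall s, y1 s = sqrt (y1 s * y1 s + y2 s * y2 s) * cos (th s) /\
              y2 s = sqrt (y1 s * y1 s + y2 s * y2 s) * sin (th s).
Proof.
  intros H1 H2 Hf Hpos Hdet.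
  set (N := fun s => y1 s * y1 s + y2 s * y2 s).
  set (r := fun s => sqrt (N s)).
  assert (Hr : forall s, 0 < r s) by (intros; apply sqrt_lt_R0, Hpos).
  assert (Hrr : forall s, r s * r s = N s)
    by (intros; apply sqrt_sqrt, Rlt_le, Hpos).
  assert (Hdr : forall s, is_derive r s ((y1 s * d1 s + y2 s * d2 s) / r s)).
  { intros s; unfold r, N; auto_derive.
    - derive_side. apply Hpos.
    - derive_values. field. specialize (Hr s); unfold r, N in Hr; lra. }
  destruct (polar_angle (y1 0 / r 0) (y2 0 / r 0)) as [t0 [E1 E2]].
  { specialize (Hr 0); specialize (Hrr 0).
    replace (y1 0 / r 0 * (y1 0 / r 0) + y2 0 / r 0 * (y2 0 / r 0))
      with (N 0 / (r 0 * r 0)) by (unfold N; field; lra).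
    rewrite Hrr; field. specialize (Hpos 0); unfold N; lra. }
  set (th := fun s => t0 + RInt f 0 s).
  assert (Hth : forall s, is_derive th s (f s)).
  { intros s; unfold th; eapply is_derive_value.
    - apply @is_derive_plus; [apply is_derive_const|].
      apply is_derive_primitive, Hf.
    - unfold plus, zero; simpl; ring. }
  assert (Hth0 : th 0 = t0)
    by (unfold th; rewrite RInt_point; unfold zero; simpl; ring).
  assert (HN : forall s, r s * r s - y1 s * y1 s - y2 s * y2 s = 0)
    by (intros s; rewrite Hrr; unfold N; ring).
  assert (Ef : forall s, f s = (y1 s * d2 s - y2 s * d1 s) / (r s * r s)).
  { intros s; rewrite <- Hdet, Hrr; fold (N s); field.
    specialize (Hpos s); fold (N s) in Hpos; lra. }
  assert (C : forall s, (y1 s * cos (th s) + y2 s * sin (th s)) / r s = 1).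
  { intros s.
    rewrite (const_of_derive_0
      (fun s => (y1 s * cos (th s) + y2 s * sin (th s)) / r s)) with (t := 0).
    - rewrite Hth0, <- E1, <- E2.
      replace (_ / r 0) with (N 0 / (r 0 * r 0))
        by (unfold N; field; specialize (Hr 0); lra).
      rewrite Hrr; field; specialize (Hpos 0); unfold N; lra.
    - clear s; intros s; specialize (Hr s).
      auto_derive.
      + derive_side; lra.
      + derive_values; rewrite Ef.
        (* With [r s] opaque, the derivative is a rational multiple of [r^2 - y1^2 - y2^2], which
           only [HN] can send to zero. *)
        transitivity ((d1 s * cos (th s) + d2 s * sin (th s)) *
          (r s * r s - y1 s * y1 s - y2 s * y2 s) / (r s * r s * r s));
          [field; lra | unfold Rdiv; rewrite (HN s); ring]. }
  assert (S : forall s, (y2 s * cos (th s) - y1 s * sin (th s)) / r s = 0).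
  { intros s.
    rewrite (const_of_derive_0
      (fun s => (y2 s * cos (th s) - y1 s * sin (th s)) / r s)) with (t := 0).
    - rewrite Hth0, <- E1, <- E2. field. specialize (Hr 0); lra.
    - clear s; intros s; specialize (Hr s).
      auto_derive.
      + derive_side; lra.
      + derive_values; rewrite Ef.
        transitivity ((d2 s * cos (th s) - d1 s * sin (th s)) *
          (r s * r s - y1 s * y1 s - y2 s * y2 s) / (r s * r s * r s));
          [field; lra | unfold Rdiv; rewrite (HN s); ring]. }
  exists th; split; [exact Hth|]; intros s; fold (N s); fold (r s).
  specialize (C s); specialize (S s); specialize (Hr s).
  assert (C' : y1 s * cos (th s) + y2 s * sin (th s) = r s)
    by (apply (Rmult_eq_reg_r (/ r s));
        [rewrite Rinv_r; [exact C | lra] | apply Rinv_neq_0_compat; lra]).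
  assert (S' : y2 s * cos (th s) - y1 s * sin (th s) = 0)
    by (apply (Rmult_eq_reg_r (/ r s));
        [rewrite Rmult_0_l; exact S | apply Rinv_neq_0_compat; lra]).
  assert (U := sin2_cos2 (th s)); unfold Rsqr in U.
  rewrite <- C'; split.
  - replace (_ * cos (th s)) with
      (y1 s * (sin (th s) * sin (th s) + cos (th s) * cos (th s))
        + sin (th s) * (y2 s * cos (th s) - y1 s * sin (th s))) by ring.
    rewrite U, S'; ring.
  - replace (_ * sin (th s)) with
      (y2 s * (sin (th s) * sin (th s) + cos (th s) * cos (th s))
        - cos (th s) * (y2 s * cos (th s) - y1 s * sin (th s))) by ring.
    rewrite U, S'; ring.
Qed.

(** The two equations give [cos (t - s) = 1]; the double-angle formula turns this into a zero of the
    sine at the half difference, and such zeros are integer multiples of pi. *)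
Lemma cos_sin_eq (s t : R) :
  cos s = cos t -> sin s = sin t -> exists k : Z, t - s = 2 * PI * IZR k.
Proof.
  intros Hc Hs.
  assert (Hd : cos (t - s) = 1).
  { rewrite cos_minus, Hc, Hs. generalize (sin2_cos2 t); unfold Rsqr; lra. }
  assert (Hh : sin ((t - s) / 2) = 0).
  { replace (t - s) with (2 * ((t - s) / 2)) in Hd by field.
    rewrite cos_2a_sin in Hd. nra. }
  destruct (sin_eq_0_0 _ Hh) as [k Hk]; exists k; lra.
Qed.

Lemma cos_sin_shift (t : R) (k : Z) :
  cos (t + 2 * PI * IZR k) = cos t /\ sin (t + 2 * PI * IZR k) = sin t.
Proof.
  assert (Hn : forall u (n : nat), cos (u + 2 * INR n * PI) = cos u /\
                                   sin (u + 2 * INR n * PI) = sin u)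
    by (intros; split; [apply cos_period | apply sin_period]).
  destruct (Z_le_gt_dec 0 k) as [Hk|Hk].
  - replace (2 * PI * IZR k) with (2 * INR (Z.to_nat k) * PI)
      by (rewrite INR_IZR_INZ, Z2Nat.id by lia; ring).
    apply Hn.
  - destruct (Hn (t + 2 * PI * IZR k) (Z.to_nat (- k))) as [A B].
    rewrite <- A, <- B.
    replace (t + 2 * PI * IZR k + 2 * INR (Z.to_nat (- k)) * PI) with t; auto.
    rewrite INR_IZR_INZ, Z2Nat.id by lia; rewrite opp_IZR; ring.
Qed.

(* [H], a primitive of [1 / g], conjugates the flow to a translation of speed
   one, so [P] is the integral of [1 / g] over one turn. *)
Lemma autonomous_angle_period (phi g : R -> R) :
  (forall s, is_derive phi s (g (phi s))) ->
  (forall u, continuous g u) -> (forall u, 0 < g u) ->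
  (forall u, g (u + 2 * PI) = g u) ->
  exists P, 0 < P /\ forall s, phi (s + P) = phi s + 2 * PI.
Proof.
  intros Hphi Hc Hpos Hper.
  set (k := fun u => / g u).
  assert (Hk : forall u, continuous k u).
  { intros u; apply (continuous_comp g Rinv); [apply Hc|].
    apply (continuous_Rinv (g u)). specialize (Hpos u); lra. }
  assert (Hkp : forall u, 0 < k u) by (intros; apply Rinv_0_lt_compat, Hpos).
  set (H := fun u => RInt k 0 u).
  assert (HH : forall u, is_derive H u (k u))
    by (intros; apply is_derive_primitive, Hk).
  assert (Hinc : forall s t, s < t -> H s < H t)
    by (apply (incr_of_derive_pos H k); auto).
  assert (Hinj : forall s t, H s = H t -> s = t).
  { intros s t E; destruct (Rtotal_order s t) as [L|[L|L]]; trivial;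
      apply Hinc in L; lra. }
  assert (Hlin : forall s, H (phi s) - s = H (phi 0) - 0).
  { intros s.
    apply (const_of_derive_0 (fun s => H (phi s) - s)); clear s; intros s.
    eapply is_derive_value.
    - apply @is_derive_minus; [|apply is_derive_id].
      apply (is_derive_comp H phi); [apply HH | apply Hphi].
    - unfold minus, plus, opp, scal, one, k; simpl; unfold mult; simpl.
      specialize (Hpos (phi s)). field; lra. }
  (* The density [1 / g] has period 2 pi, so [H] gains the same amount over every turn, whatever its
     starting point. *)
  assert (Hsh : forall u, H (u + 2 * PI) - H u = H (0 + 2 * PI) - H 0).
  { intros u.
    apply (same_derive_diff (fun u => H (u + 2 * PI)) H k); [|exact HH].
    intros v; apply is_derive_shift.
    replace (k v) with (k (v + 2 * PI)); [apply HH|].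
    unfold k; now rewrite Hper. }
  exists (H (0 + 2 * PI) - H 0); split.
  - assert (P := PI_RGT_0).
    assert (H 0 < H (0 + 2 * PI)) by (apply Hinc; lra). lra.
  - intros s; apply Hinj.
    generalize (Hsh (phi s)) (Hlin s) (Hlin (s + (H (0 + 2 * PI) - H 0))); lra.
Qed.

Lemma periodic_mult (f : R -> R) (P : R) (n : nat) :
  (forall s, f (s + P) = f s) -> forall s, f (s + INR n * P) = f s.
Proof.
  intros H; induction n as [|n IH]; intros s.
  - f_equal; simpl; ring.
  - rewrite S_INR.
    replace (s + (INR n + 1) * P) with (s + INR n * P + P) by ring.
    now rewrite H.
Qed.

Lemma least_period_divides (f : R -> R) (P L : R) :
  least_period f P -> 0 < L -> (forall s, f (s + L) = f s) ->
  exists q : nat, (0 < q)%nat /\ L = INR q * P.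
Proof.
  intros (HP & Hper & Hmin) HL HfL.
  destruct (nfloor_ex (L / P)) as [q [Q1 Q2]].
  { apply Rlt_le, Rdiv_lt_0_compat; lra. }
  assert (E : L = L / P * P) by (field; lra).
  assert (A1 : INR q * P <= L) by (rewrite E; apply Rmult_le_compat_r; lra).
  assert (A2 : L < (INR q + 1) * P)
    by (rewrite E; apply Rmult_lt_compat_r; lra).
  (* Euclidean division: a nonzero remainder [L - q P] would be a positive period smaller than
     [P]. *)
  assert (E2 : L = INR q * P).
  { destruct (Req_dec L (INR q * P)) as [|Hne]; trivial; exfalso.
    assert (P <= L - INR q * P); [|lra].
    apply Hmin; [lra|]; intros s.
    rewrite <- (periodic_mult f P q Hper).
    replace (s + (L - INR q * P) + INR q * P) with (s + L) by ring.
    apply HfL. }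
  exists q; split; trivial.
  destruct q; [simpl in E2; lra | lia].
Qed.

(** * The curvature equation and the progression angle *)

(** The first integral reads [b^2 B = K^2 B - B^3 - 4], and [- sg] is the negative root of this
    cubic. The polynomial used here equals -4 at [K] and is positive at [K + 2]. *)
Lemma third_root (K : R) :
  0 < K -> exists sg, K < sg /\ sg ^ 3 = K ^ 2 * sg + 4.
Proof.
  intros HK.
  destruct (IVT (fun t => t ^ 3 - K ^ 2 * t - 4) K (K + 2)) as [z [Hz Ez]].
  - apply derivable_continuous.
    intros t; apply ex_derive_Reals_0; auto_derive; trivial.
  - lra.
  - nra.
  - nra.
  - exists z; split; [|lra].
    destruct (Req_dec z K) as [->|]; [nra|lra].
Qed.

(* [c] is the slope at [X = mu] of the concave function
   [(1 + 2 X) (S q + 1 / S) / 2] with [q = (1 - X) / (1 - mu^2 X) = 1 / tau^2];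
   it dominates [(1 + 2 X) / tau] by AM-GM, with equality at [X = mu]. *)
Lemma tangent_line_bound (mu : R) :
  0 < mu -> 2 * mu ^ 2 + 2 * mu < 1 ->
  exists L c, L < sqrt 2 /\
  forall X tau, 0 < X < 1 -> 0 < tau -> tau ^ 2 * (1 - X) = 1 - mu ^ 2 * X ->
    1 + 2 * X <= tau * (L + c * (X - mu)).
Proof.
  intros H0 Hmu.
  assert (H1 : mu < 1) by nra.
  (* The value of [tau] at [X = mu], since [(1 - mu^3) / (1 - mu) = 1 + mu + mu^2]. *)
  set (S := sqrt (1 + mu + mu ^ 2)).
  assert (HS : 0 < S) by (apply sqrt_lt_R0; nra).
  assert (HSS : S * S = 1 + mu + mu ^ 2) by (apply sqrt_sqrt; nra).
  (* The derivative at [X = mu] of [(1 + 2 X) (1 - X) / (1 - mu^2 X)]. *)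
  set (N1 := ((1 - 4 * mu) * (1 - mu ^ 3) + mu ^ 2 * (1 - mu) * (1 + 2 * mu))
             / (1 - mu ^ 3) ^ 2).
  exists ((1 + 2 * mu) / S), (1 / S + S / 2 * N1).
  assert (Hm3 : 0 < 1 - mu ^ 3).
  { replace (1 - mu ^ 3) with ((1 - mu) * (1 + mu + mu ^ 2)) by ring.
    apply Rmult_lt_0_compat; nra. }
  split.
  (* After squaring, the claim is [(1 + 2 mu)^2 < 2 (1 + mu + mu^2)], which is exactly the
     hypothesis on [mu]. *)
  - apply Rsqr_incrst_0; [|apply Rlt_le, Rdiv_lt_0_compat; lra|apply sqrt_pos].
    unfold Rsqr; rewrite sqrt_sqrt by lra.
    replace ((1 + 2 * mu) / S * ((1 + 2 * mu) / S))
      with ((1 + 2 * mu) ^ 2 / (S * S)) by (field; lra).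
    apply Rmult_lt_reg_r with (S * S); [nra|].
    replace ((1 + 2 * mu) ^ 2 / (S * S) * (S * S)) with ((1 + 2 * mu) ^ 2)
      by (field; lra).
    rewrite HSS; nra.
  - intros X tau HX Ht Eq.
    assert (Hd : 0 < 1 - mu ^ 2 * X) by nra.
    set (q := (1 - X) / (1 - mu ^ 2 * X)).
    assert (Hq : q = / (tau * tau)).
    { unfold q; replace (1 - X) with ((1 - mu ^ 2 * X) / (tau * tau))
        by (rewrite <- Eq; field; lra).
      field; lra. }
    assert (A : 1 <= tau * ((S * q + 1 / S) / 2)).
    { replace (tau * ((S * q + 1 / S) / 2))
        with (1 + (S - tau) ^ 2 / (2 * tau * S)) by (rewrite Hq; field; lra).
      assert (0 <= (S - tau) ^ 2 / (2 * tau * S)); [|lra].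
      apply Rdiv_le_0_compat; [apply pow2_ge_0 | nra]. }
    assert (B : (1 + 2 * X) * ((S * q + 1 / S) / 2)
                <= (1 + 2 * mu) / S + (1 / S + S / 2 * N1) * (X - mu)).
    (* The gap between the tangent line and the function, in closed form: a double zero at [mu]
       times a positive factor. *)
    { assert (E : (1 + 2 * mu) / S + (1 / S + S / 2 * N1) * (X - mu)
        - (1 + 2 * X) * ((S * q + 1 / S) / 2)
        = S / 2 * ((X - mu) ^ 2 * ((1 - mu ^ 2) * (2 + mu ^ 2))
             / ((1 - mu ^ 2 * X) * (1 - mu ^ 3) ^ 2))).
      (* The two sides differ by a multiple of [1 / S - S (1 - mu) / (1 - mu^3)], which vanishes by
         the value of [S^2] but not by field reasoning alone. *)
      { apply Rminus_diag_uniq.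
        transitivity ((1 + 2 * mu) / 2 * (1 / S - S * ((1 - mu) / (1 - mu ^ 3)))).
        - unfold q, N1; field; repeat split; try lra.
        - replace (1 / S - S * ((1 - mu) / (1 - mu ^ 3))) with
            ((1 - mu ^ 3 - (S * S) * (1 - mu)) / (S * (1 - mu ^ 3)))
            by (field; lra).
          rewrite HSS; field; lra. }
      assert (0 <= S / 2 * ((X - mu) ^ 2 * ((1 - mu ^ 2) * (2 + mu ^ 2))
             / ((1 - mu ^ 2 * X) * (1 - mu ^ 3) ^ 2))); [|lra].
      apply Rmult_le_pos; [lra|].
      apply Rdiv_le_0_compat.
      - apply Rmult_le_pos; [apply pow2_ge_0 | apply Rmult_le_pos; nra].
      - apply Rmult_lt_0_compat; [lra | apply pow_lt; lra]. }
    apply Rle_trans with ((1 + 2 * X) * (tau * ((S * q + 1 / S) / 2))).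
    + rewrite <- (Rmult_1_r (1 + 2 * X)) at 1; apply Rmult_le_compat_l; lra.
    + replace ((1 + 2 * X) * (tau * ((S * q + 1 / S) / 2)))
        with (tau * ((1 + 2 * X) * ((S * q + 1 / S) / 2))) by ring.
      apply Rmult_le_compat_l; lra.
Qed.

(** * The oscillator satisfied by [B = rho^2], with its first integral *)

Definition profile (K : R) (rho b : R -> R) : Prop :=
  0 < K /\
  (forall s, 0 < rho s) /\
  (forall s, is_derive rho s (b s / (2 * rho s))) /\
  (forall s, is_derive b s (2 / rho s ^ 4 - rho s ^ 2)) /\
  (forall s, b s ^ 2 = K ^ 2 - rho s ^ 4 - 4 / rho s ^ 2).

(** The term [4 / B] of the first integral is positive, so [B^2 < K^2]. Geometrically, the curve
    never meets the axis. *)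
Lemma profile_lt (K : R) (rho b : R -> R) :
  profile K rho b -> forall s, 0 < rho s ^ 2 < K.
Proof.
  intros (HK & Hr & _ & _ & HE) s; specialize (Hr s); specialize (HE s).
  assert (0 < 4 / rho s ^ 2) by (apply Rdiv_lt_0_compat; nra).
  split; nra.
Qed.

Lemma profile_periodic (K : R) (rho b : R -> R) (P : R) :
  profile K rho b -> (forall s, rho (s + P) = rho s) ->
  forall s, b (s + P) = b s.
Proof.
  intros (HK & Hr & Hdr & _) HP s.
  assert (E : b (s + P) / (2 * rho (s + P)) = b s / (2 * rho s)).
  { rewrite <- (is_derive_unique _ _ _ (Hdr s)). symmetry.
    rewrite (Derive_ext rho (fun t => rho (t + P))) by (intros; now rewrite HP).
    apply is_derive_unique, is_derive_shift, Hdr. }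
  rewrite HP in E. specialize (Hr s).
  apply (Rmult_eq_reg_r (/ (2 * rho s))); [exact E|].
  apply Rinv_neq_0_compat; lra.
Qed.

Lemma atan_derive (u u' : R -> R) :
  (forall s, is_derive u s (u' s)) ->
  forall s, is_derive (fun t => atan (u t)) s (u' s / (1 + u s ^ 2)).
Proof.
  intros H s; eapply is_derive_value.
  - apply (is_derive_comp atan u); [|apply H].
    apply is_derive_Reals, derivable_pt_lim_atan.
  - unfold scal; simpl; unfold mult, Rsqr, Rdiv; simpl; ring_simplify; f_equal.
Qed.

(** The cubic [b^2 B] factors as [(B + sg) (- B^2 + sg B - 4 / sg)], and [B + sg = sg tau^2].
    Dividing by [4 B^2 tau^2] and completing the square in [1 / B] gives
    [y2^2 = a^2 - (1 / B - m)^2]. Hence [(1 / B - m, y2)] moves on a circle of radius [a], and [phi]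
    is its lifted polar angle. *)
Lemma profile_phase (K sg : R) (rho b : R -> R) :
  profile K rho b -> K < sg -> sg ^ 3 = K ^ 2 * sg + 4 ->
  (exists s, b s <> 0) ->
  16 < sg ^ 3 /\
  let m := sg ^ 2 / 8 in
  let a := sqrt (m ^ 2 - sg / 4) in
  let tau := fun s => sqrt (1 + rho s ^ 2 / sg) in
  let y2 := fun s => b s / (2 * rho s * tau s) in
  0 < a < m /\
  (forall s, is_derive y2 s (2 * tau s / rho s ^ 3 * (/ rho s ^ 2 - m))) /\
  (forall s, (/ rho s ^ 2 - m) ^ 2 + y2 s ^ 2 = a ^ 2) /\
  exists phi : R -> R,
    (forall s, is_derive phi s (2 * tau s / rho s ^ 3)) /\
    (forall s, / rho s ^ 2 - m = a * cos (phi s)) /\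
    (forall s, y2 s = a * sin (phi s)).
Proof.
  intros HP Hsg Esg [s0 Hs0].
  assert (HP' := HP); destruct HP' as (HK & Hr & Hdr & Hdb & HE).
  assert (EK : K ^ 2 = sg ^ 2 - 4 / sg).
  { apply (Rmult_eq_reg_r sg); [|lra].
    replace ((sg ^ 2 - 4 / sg) * sg) with (sg ^ 3 - 4) by (field; lra). lra. }
  (* This is [sg] times the quadratic factor of the cubic, positive wherever [b] does not vanish. *)
  assert (Hq : 0 < - 4 + sg ^ 2 * rho s0 ^ 2 - sg * rho s0 ^ 4).
  { assert (Hb : 0 < b s0 ^ 2) by (apply pow2_gt_0; exact Hs0).
    rewrite HE, EK in Hb. specialize (Hr s0).
    assert (F : (- 4 + sg ^ 2 * rho s0 ^ 2 - sg * rho s0 ^ 4) *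
      ((rho s0 ^ 2 + sg) / (sg * rho s0 ^ 2)) =
      sg ^ 2 - 4 / sg - rho s0 ^ 4 - 4 / rho s0 ^ 2) by (field; lra).
    rewrite <- F in Hb.
    assert (0 < (rho s0 ^ 2 + sg) / (sg * rho s0 ^ 2)).
    { apply Rdiv_lt_0_compat; [nra|]. apply Rmult_lt_0_compat; nra. }
    nra. }
  (* A concave quadratic in [B] with a positive value has positive discriminant, here
     [sg^4 - 16 sg]. *)
  assert (H16 : 16 < sg ^ 3).
  { assert (sg * 16 < sg * sg ^ 3); [|nra].
    set (B := rho s0 ^ 2) in *.
    replace (rho s0 ^ 4) with (B ^ 2) in Hq by (unfold B; ring).
    assert (0 <= (2 * sg * B - sg ^ 2) ^ 2) by apply pow2_ge_0.
    nra. }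
  split; [exact H16|]. intros m a tau y2.
  assert (Hm : 0 < m) by (unfold m; nra).
  assert (Ham : 0 < m ^ 2 - sg / 4).
  { unfold m. replace ((sg ^ 2 / 8) ^ 2 - sg / 4)
      with (sg * (sg ^ 3 - 16) / 64) by field. nra. }
  assert (Ha : 0 < a) by (apply sqrt_lt_R0; exact Ham).
  assert (Haa : a ^ 2 = m ^ 2 - sg / 4)
    by (simpl; rewrite Rmult_1_r; apply sqrt_sqrt; simpl in Ham; lra).
  assert (Htp : forall s, 0 < 1 + rho s ^ 2 / sg).
  { intros s; specialize (Hr s).
    assert (0 < rho s ^ 2 / sg) by (apply Rdiv_lt_0_compat; nra). lra. }
  assert (Ht : forall s, 0 < tau s) by (intros; apply sqrt_lt_R0, Htp).
  assert (Htt : forall s, tau s ^ 2 = 1 + rho s ^ 2 / sg)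
    by (intros s; simpl; rewrite Rmult_1_r; apply sqrt_sqrt, Rlt_le, Htp).
  assert (Hdt : forall s, is_derive tau s (b s / (2 * sg * tau s))).
  { intros s; unfold tau; auto_derive.
    - derive_side. specialize (Htp s); simpl in Htp; lra.
    - derive_values. fold (tau s). specialize (Ht s). specialize (Hr s).
      replace (sqrt _) with (tau s) by (unfold tau; f_equal; simpl; ring).
      field; lra. }
  assert (Hy1 : forall s, is_derive (fun s => / rho s ^ 2 - m) s
                            (- (2 * tau s / rho s ^ 3) * y2 s)).
  { intros s; specialize (Ht s); auto_derive.
    - derive_side. specialize (Hr s); nra.
    - derive_values. unfold y2. specialize (Hr s); field; lra. }
  assert (Hy2 : forall s, is_derive y2 s
                            (2 * tau s / rho s ^ 3 * (/ rho s ^ 2 - m))).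
  { intros s; unfold y2; auto_derive.
    - derive_side. specialize (Hr s); specialize (Ht s). nra.
    - derive_values. specialize (Hr s); specialize (Ht s).
      transitivity ((2 / rho s ^ 4 - rho s ^ 2 - b s ^ 2 / (2 * rho s ^ 2)
         - b s ^ 2 / (2 * sg * tau s ^ 2)) / (2 * rho s * tau s));
        [field; lra|].
      transitivity (tau s ^ 2 * (4 / rho s ^ 2 * (/ rho s ^ 2 - m))
                     / (2 * rho s * tau s)); [|field; lra].
      f_equal. rewrite HE, EK, Htt; unfold m; field.
      repeat split; try lra; nra. }
  assert (Hy12 : forall s, (/ rho s ^ 2 - m) ^ 2 + y2 s ^ 2 = a ^ 2).
  { intros s; rewrite Haa; unfold y2; specialize (Hr s); specialize (Ht s).
    transitivity ((/ rho s ^ 2 - m) ^ 2 + b s ^ 2 / (4 * rho s ^ 2 * tau s ^ 2));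
      [field; lra|].
    rewrite HE, EK, Htt; unfold m; field.
    repeat split; try lra; nra. }
  split; [nra|]. split; [exact Hy2|]. split; [exact Hy12|].
  assert (Hsum : forall s, (/ rho s ^ 2 - m) * (/ rho s ^ 2 - m) + y2 s * y2 s
                           = a * a)
    by (intros s; specialize (Hy12 s); simpl in *; lra).
  destruct (angle_lift (fun s => / rho s ^ 2 - m) y2
    (fun s => - (2 * tau s / rho s ^ 3) * y2 s)
    (fun s => 2 * tau s / rho s ^ 3 * (/ rho s ^ 2 - m))
    (fun s => 2 * tau s / rho s ^ 3)) as [phi [P1 P2]].
  - exact Hy1.
  - exact Hy2.
  - intros s; apply (ex_derive_continuous (fun s => 2 * tau s / rho s ^ 3)).
    auto_derive; derive_side. specialize (Hr s). simpl; apply Rgt_not_eq, Rmult_lt_0_compat; nra.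
  - intros s; rewrite Hsum; nra.
  - intros s; ring.
  - exists phi; split; [exact P1|].
    assert (Hsq : sqrt (a * a) = a) by (apply sqrt_square; lra).
    split; intros s; specialize (P2 s); rewrite Hsum, Hsq in P2; apply P2.
Qed.

(** Since [1 / B = v] is a function of [phi], the phase obeys the autonomous equation
    [phi' = 2 v sqrt (v + 1 / sg)], and one turn of it takes a fixed time. Conversely, a period of
    [rho] restores the cosine and sine of [phi]; a period shorter than one turn would advance the
    increasing [phi] by a multiple of 2 pi strictly between 0 and 2 pi. *)
Lemma profile_least_period (K sg a : R) (rho b phi : R -> R) :
  profile K rho b -> 0 < sg ->
  let m := sg ^ 2 / 8 in
  let tau := fun s => sqrt (1 + rho s ^ 2 / sg) in
  0 < a < m ->
  (forall s, is_derive phi s (2 * tau s / rho s ^ 3)) ->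
  (forall s, / rho s ^ 2 - m = a * cos (phi s)) ->
  (forall s, b s / (2 * rho s * tau s) = a * sin (phi s)) ->
  exists P, least_period rho P /\ forall s, phi (s + P) = phi s + 2 * PI.
Proof.
  intros HP Hsg m tau Ha Hphi Hc Hs.
  assert (HP' := HP); destruct HP' as (HK & Hr & Hdr & Hdb & HE).
  assert (Ht : forall s, 0 < tau s).
  { intros s; apply sqrt_lt_R0. specialize (Hr s).
    assert (0 < rho s ^ 2 / sg) by (apply Rdiv_lt_0_compat; nra). lra. }
  set (v := fun u => m + a * cos u).
  assert (Hv : forall u, 0 < v u).
  { intros u; unfold v; generalize (COS_bound u); nra. }
  assert (Hvs : forall u, 0 < v u + / sg)
    by (intros u; generalize (Hv u) (Rinv_0_lt_compat sg Hsg); lra).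
  set (g := fun u => 2 * v u * sqrt (v u + / sg)).
  assert (Hvr : forall s, v (phi s) = / rho s ^ 2)
    by (intros s; unfold v; rewrite <- Hc; ring).
  destruct (autonomous_angle_period phi g) as [P [P0 PP]].
  - intros s. replace (g (phi s)) with (2 * tau s / rho s ^ 3); [apply Hphi|].
    specialize (Hr s).
    unfold g; rewrite Hvr.
    replace (/ rho s ^ 2 + / sg) with ((1 + rho s ^ 2 / sg) / (rho s * rho s))
      by (field; lra).
    rewrite sqrt_div_alt by nra. rewrite sqrt_square by lra.
    fold (tau s); field; lra.
  - intros u; apply (ex_derive_continuous g).
    unfold g, v; auto_derive. split_all. exact (Hvs u).
  - intros u; unfold g.
    apply Rmult_lt_0_compat; [specialize (Hv u); lra | apply sqrt_lt_R0, Hvs].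
  - intros u; unfold g, v.
    now rewrite cos_plus, cos_2PI, sin_2PI, Rmult_1_r, Rmult_0_r, Rminus_0_r.
  - exists P; split; [|exact PP].
    assert (Hinc : forall s t, s < t -> phi s < phi t).
    { apply (incr_of_derive_pos _ _ Hphi); intros s.
      apply Rdiv_lt_0_compat; [specialize (Ht s); lra | apply pow_lt, Hr]. }
    split; [exact P0|]; split.
    + intros s.
      assert (E : / rho (s + P) ^ 2 = / rho s ^ 2).
      { rewrite <- !Hvr; unfold v; rewrite PP, cos_plus, cos_2PI, sin_2PI.
        ring. }
      apply Rinv_eq_reg in E.
      generalize (Hr s) (Hr (s + P)); nra.
    + intros P' HP0 HPer.
      assert (Hb := profile_periodic K rho b P' HP HPer).
      destruct (Rle_dec P P') as [|Hlt]; trivial; exfalso.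
      destruct (cos_sin_eq (phi 0) (phi (0 + P'))) as [k Hk].
      * apply (Rmult_eq_reg_l a); [|lra]. rewrite <- !Hc, HPer; trivial.
      * apply (Rmult_eq_reg_l a); [|lra].
        rewrite <- !Hs; unfold tau; rewrite HPer, Hb; trivial.
      * assert (H1 : phi 0 < phi (0 + P')) by (apply Hinc; lra).
        assert (H2 : phi (0 + P') < phi (0 + P)) by (apply Hinc; lra).
        rewrite PP in H2. assert (Hpi := PI_RGT_0).
        assert (K1 : 0 < IZR k) by nra.
        assert (K2 : IZR k < 1) by nra.
        apply lt_IZR in K1; apply lt_IZR in K2; lia.
Qed.

(* [alpha] is the angle from the unit tangent to the Killing field J, up to
   sign; its derivative has the same pole at [rho^2 = K] as the angular
   velocity, and this removes the pole. *)
Lemma profile_alpha (K : R) (rho b : R -> R) :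
  profile K rho b ->
  forall s, is_derive (fun s => atan (b s * rho s / 2)) s
    ((K ^ 2 - 3 * rho s ^ 4) / (rho s ^ 3 * (K ^ 2 - rho s ^ 4))).
Proof.
  intros HP s; assert (HB := profile_lt _ _ _ HP s).
  destruct HP as (HK & Hr & Hdr & Hdb & HE).
  eapply is_derive_value.
  - apply (atan_derive (fun s => b s * rho s / 2)
      (fun s => ((2 / rho s ^ 4 - rho s ^ 2) * rho s + b s ^ 2 / (2 * rho s)) / 2)).
    clear s HB; intros s; auto_derive; [derive_side|].
    derive_values. specialize (Hr s); field; lra.
  - simpl. specialize (Hr s).
    assert (0 < K ^ 2 - rho s ^ 4) by nra.
    (* By the first integral, this is [rho^2 (K^2 - rho^4) / 4], the source of the pole. *)
    replace (1 + b s * rho s / 2 * (b s * rho s / 2 * 1))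
      with (1 + b s ^ 2 * rho s ^ 2 / 4) by field.
    replace (b s * (b s * 1)) with (b s ^ 2) by ring.
    rewrite HE; field.
    repeat split; try lra; nra.
Qed.

(* [2 omega] is the difference of the eccentric angle [phi] and of the angle
   for which [1 / (1 + K / rho^2)], instead of [1 / rho^2], is an affine
   function of the cosine. *)
Lemma profile_omega (K sg mu a : R) (rho f y2 : R -> R) :
  0 < K -> 0 < sg -> 0 < mu -> K = sg * (1 - mu ^ 2) ->
  sg ^ 3 = K ^ 2 * sg + 4 ->
  let m := sg ^ 2 / 8 in
  a ^ 2 = m ^ 2 - sg / 4 ->
  (forall s, 0 < rho s) ->
  (forall s, is_derive (fun s => / rho s ^ 2) s (- f s * y2 s)) ->
  (forall s, is_derive y2 s (f s * (/ rho s ^ 2 - m))) ->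
  (forall s, (/ rho s ^ 2 - m) ^ 2 + y2 s ^ 2 = a ^ 2) ->
  forall s, is_derive (fun s => atan (y2 s / (/ rho s ^ 2 + (1 + / mu) / K))) s
    (f s / 2 * (1 - rho s ^ 2 / (rho s ^ 2 + K) / mu)).
Proof.
  intros HK Hsg Hmu EK Esg m Eaa Hr Hv Hy2 Hy12 s.
  set (v := fun s => / rho s ^ 2).
  change (forall s, is_derive v s (- f s * y2 s)) in Hv.
  change (forall s, is_derive y2 s (f s * (v s - m))) in Hy2.
  change (forall s, (v s - m) ^ 2 + y2 s ^ 2 = a ^ 2) in Hy12.
  change (is_derive (fun s => atan (y2 s / (v s + (1 + / mu) / K))) s
    (f s / 2 * (1 - rho s ^ 2 / (rho s ^ 2 + K) / mu))).
  assert (Hvp : forall s, 0 < v s)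
    by (intros; apply Rinv_0_lt_compat, pow_lt, Hr).
  (* The sum of [1 / K] and [1 / (K mu)]. The point [- 1 / K] is the pole of [1 / (1 + K v)], and by
     [EN] below [1 / (K mu)] is the length of the tangent drawn from it to the circle of centre [m]
     and radius [a]. *)
  set (n := (1 + / mu) / K).
  assert (Hn : 0 < n).
  { apply Rdiv_lt_0_compat; [|lra]. generalize (Rinv_0_lt_compat mu Hmu); lra. }
  (* [(v - m)^2 + y2^2 = a^2] makes [(v + n)^2 + y2^2] linear in [v]. *)
  set (N := m + / K).
  assert (EN : N ^ 2 = a ^ 2 + (/ (K * mu)) ^ 2).
  { assert (Hmu1 : 0 < 1 - mu ^ 2) by nra.
    assert (E4 : sg ^ 3 * (mu ^ 2 * (2 - mu ^ 2)) = 4)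
      by (rewrite EK in Esg; lra).
    rewrite Eaa; unfold N, m.
    apply Rminus_diag_uniq.
    transitivity ((1 - mu ^ 2) * (sg ^ 3 * (mu ^ 2 * (2 - mu ^ 2)) - 4)
      / (4 * mu ^ 2 * K ^ 2)).
    - rewrite EK; field. repeat split; lra.
    - rewrite E4; field; lra. }
  eapply is_derive_value.
  - apply (atan_derive (fun s => y2 s / (v s + n))
      (fun s => f s * ((v s - m) * (v s + n) + y2 s ^ 2) / (v s + n) ^ 2)).
    clear s; intros s; auto_derive.
    + derive_side. specialize (Hvp s); lra.
    + derive_values. specialize (Hvp s); field; lra.
  - cbv beta. specialize (Hvp s); specialize (Hy12 s).
    replace (rho s ^ 2) with (/ v s)
      by (unfold v; apply Rinv_inv).
    replace (v s - m) with (v s + / K - N) in * by (unfold N; ring).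
    assert (Ey : y2 s ^ 2 = a ^ 2 - (v s + / K - N) ^ 2) by lra.
    assert (Ea : a ^ 2 = N ^ 2 - (/ (K * mu)) ^ 2) by lra.
    assert (HN : 0 < N).
    { unfold N, m. assert (0 < / K) by (apply Rinv_0_lt_compat; lra). nra. }
    assert (HR : 0 < / (K * mu)) by (apply Rinv_0_lt_compat; nra).
    set (w := v s + / K) in *.
    assert (En : v s + n = w + / (K * mu))
      by (unfold w, n; field; lra).
    rewrite En.
    assert (Hw : 0 < w)
      by (unfold w; generalize (Rinv_0_lt_compat K HK); lra).
    set (R0 := / (K * mu)) in *.
    transitivity (f s * ((w - N) * (w + R0) + y2 s ^ 2)
       / ((w + R0) ^ 2 + y2 s ^ 2)).
    + field. split; [apply Rgt_not_eq; nra | lra].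
    + rewrite Ey, Ea.
      assert (HNw : 0 < 2 * w * (N + R0)) by nra.
      (* The common factor [N + R0] cancels and leaves [1 - R0 / w], where [R0 / w] is
         [rho^2 / (rho^2 + K)] divided by [mu]. *)
      transitivity (f s * (w * (N + R0) - R0 * (N + R0)) / (2 * w * (N + R0))).
      * f_equal; ring.
      * transitivity (f s / 2 * (1 - R0 / w)); [field; lra|].
        f_equal; f_equal; unfold R0, w; field.
        repeat split; try lra; nra.
Qed.

(** Averages over a period are replaced by monotonicity: [th + alpha - phi / 2] increases, and
    [L phi / 2 - c mu omega - th - alpha] does not decrease. Over one period [alpha] and [omega]
    return to their values while [phi] gains 2 pi, so both bounds on the increment of [th] can be
    read off. *)
Lemma profile_progression (K : R) (rho b : R -> R) :
  profile K rho b -> (exists s, b s <> 0) ->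
  exists P, least_period rho P /\
  forall th : R -> R,
    (forall s, is_derive th s (2 * K / (rho s * (K ^ 2 - rho s ^ 4)))) ->
    forall s, PI < th (s + P) - th s < PI * sqrt 2.
Proof.
  intros HP Hne.
  assert (HP' := HP); destruct HP' as (HK & Hr & Hdr & Hdb & HE).
  destruct (third_root K HK) as [sg [Hsg Esg]].
  destruct (profile_phase K sg rho b HP Hsg Esg Hne)
    as (H16 & Ham & Hy2 & Hy12 & phi & Hphi & Hc & Hs).
  set (m := sg ^ 2 / 8) in *. set (a := sqrt (m ^ 2 - sg / 4)) in *.
  assert (Eaa : a ^ 2 = m ^ 2 - sg / 4).
  { simpl; rewrite Rmult_1_r; apply sqrt_sqrt.
    apply Rnot_lt_le; intros Hn.
    assert (a = 0) by (apply sqrt_neg_0; simpl in *; lra). lra. }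
  destruct (profile_least_period K sg a rho b phi HP) as (P & HPP & Hturn);
    try assumption; try lra.
  exists P; split; [exact HPP|]; intros th Hth s.
  assert (HPr := proj1 (proj2 HPP)).
  assert (HPb := profile_periodic K rho b P HP HPr).
  set (tau := fun s => sqrt (1 + rho s ^ 2 / sg)).
  set (f := fun s => 2 * tau s / rho s ^ 3).
  set (y2 := fun s => b s / (2 * rho s * tau s)).
  change (forall s, is_derive phi s (f s)) in Hphi.
  change (forall s, is_derive y2 s (f s * (/ rho s ^ 2 - m))) in Hy2.
  change (forall s, (/ rho s ^ 2 - m) ^ 2 + y2 s ^ 2 = a ^ 2) in Hy12.
  assert (HB := profile_lt _ _ _ HP).
  assert (Htp : forall s, 0 < rho s ^ 2 / sg).
  { intros t; specialize (HB t). apply Rdiv_lt_0_compat; lra. }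
  assert (Ht : forall s, 0 < tau s).
  { intros t; apply sqrt_lt_R0. specialize (Htp t). lra. }
  assert (Htt : forall s, tau s ^ 2 = 1 + rho s ^ 2 / sg).
  { intros t; simpl; rewrite Rmult_1_r; apply sqrt_sqrt.
    specialize (Htp t); simpl in Htp; lra. }
  set (X := fun s => rho s ^ 2 / (rho s ^ 2 + K)).
  assert (HX : forall s, 0 < X s < 1).
  { intros t; specialize (HB t); unfold X; split.
    - apply Rdiv_lt_0_compat; lra.
    - apply Rmult_lt_reg_r with (rho t ^ 2 + K); [lra|].
      unfold Rdiv; rewrite Rmult_assoc, Rinv_l by lra. lra. }
  set (mu := sqrt (1 - K / sg)).
  assert (Hk : 0 < 1 - K / sg).
  { replace (1 - K / sg) with ((sg - K) / sg) by (field; lra).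
    apply Rdiv_lt_0_compat; lra. }
  assert (Hmu : 0 < mu) by (apply sqrt_lt_R0, Hk).
  assert (Hmm : mu ^ 2 = 1 - K / sg)
    by (simpl; rewrite Rmult_1_r; apply sqrt_sqrt; lra).
  assert (EKs : K = sg * (1 - mu ^ 2)) by (rewrite Hmm; field; lra).
  assert (Hmu1 : mu ^ 2 < 1).
  { rewrite Hmm. assert (0 < K / sg) by (apply Rdiv_lt_0_compat; lra). lra. }
  (* With [K = sg (1 - mu^2)] the cubic equation becomes [E4], so [16 < sg^3] bounds [mu]; the bound
     [F] says [(1 - 2 mu^2)^2 > 4 mu^2], which factors as a difference of squares. *)
  assert (Hmu2 : 2 * mu ^ 2 + 2 * mu < 1).
  { assert (E4 : sg ^ 3 * (mu ^ 2 * (2 - mu ^ 2)) = 4)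
      by (rewrite EKs in Esg; lra).
    assert (F : 4 * (mu ^ 2 * (2 - mu ^ 2)) < 1) by nra.
    assert (G : 0 < (1 - 2 * mu ^ 2 - 2 * mu) * (1 - 2 * mu ^ 2 + 2 * mu)) by nra.
    assert (0 < 1 - 2 * mu ^ 2 + 2 * mu) by nra.
    nra. }
  set (alpha := fun s => atan (b s * rho s / 2)).
  assert (Ha := profile_alpha K rho b HP : forall s, is_derive alpha s _).
  set (omega := fun s => atan (y2 s / (/ rho s ^ 2 + (1 + / mu) / K))).
  assert (Ho : forall s, is_derive omega s (f s / 2 * (1 - X s / mu))).
  { apply (profile_omega K sg mu a rho f y2); auto; try lra.
    clear s; intros s; auto_derive.
    - derive_side. specialize (Hr s); nra.
    - derive_values. unfold y2, f.
      specialize (Hr s); specialize (Ht s); field; lra. }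
  assert (Eal : alpha (s + P) = alpha s) by (unfold alpha; now rewrite HPr, HPb).
  assert (Eom : omega (s + P) = omega s)
    by (unfold omega, y2, tau; now rewrite HPr, HPb).
  (* the two poles at [rho^2 = K] cancel in [th' + alpha'] *)
  assert (Eta : forall s, 2 * K / (rho s * (K ^ 2 - rho s ^ 4)) +
     (K ^ 2 - 3 * rho s ^ 4) / (rho s ^ 3 * (K ^ 2 - rho s ^ 4))
     = (1 + 2 * X s) / rho s ^ 3).
  { intros t; unfold X; specialize (Hr t); specialize (HB t).
    assert (0 < K ^ 2 - rho t ^ 4) by nra.
    field. repeat split; nra. }
  assert (HP0 : s < s + P) by (generalize (proj1 HPP); lra).
  specialize (Hturn s).
  split.
  - assert (W : th s + alpha s - phi s / 2 <
                th (s + P) + alpha (s + P) - phi (s + P) / 2); [|lra].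
    apply (incr_of_derive_pos (fun s => th s + alpha s - phi s / 2)
       (fun s => (1 + 2 * X s - tau s) / rho s ^ 3)); [| |exact HP0].
    + clear s Eal Eom HP0 Hturn; intros s; auto_derive.
      * derive_side.
      * derive_values. rewrite Rmult_1_l, Rmult_1_l, Eta. unfold f.
        specialize (Hr s); field; lra.
    + clear s Eal Eom HP0 Hturn; intros s.
      apply Rdiv_lt_0_compat; [|apply pow_lt, Hr].
      specialize (HX s); specialize (Htt s); specialize (Ht s).
      (* This gives [tau^2 < 1 + 4 X < (1 + 2 X)^2]. Cleared of denominators it is
         [rho^2 + K < 4 sg], and both terms on the left are below [sg]. *)
      assert (rho s ^ 2 / sg < 4 * X s); [|nra].
      specialize (HB s); unfold X.
      apply Rmult_lt_reg_r with (sg * (rho s ^ 2 + K)); [nra|].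
      replace (rho s ^ 2 / sg * (sg * (rho s ^ 2 + K)))
        with (rho s ^ 2 * (rho s ^ 2 + K)) by (field; lra).
      replace (4 * (rho s ^ 2 / (rho s ^ 2 + K)) * (sg * (rho s ^ 2 + K)))
        with (rho s ^ 2 * (4 * sg)) by (field; lra).
      apply Rmult_lt_compat_l; lra.
  - destruct (tangent_line_bound mu Hmu Hmu2) as (L & c & HL & HLc).
    assert (W : L / 2 * phi s - c * mu * omega s - th s - alpha s <=
      L / 2 * phi (s + P) - c * mu * omega (s + P) - th (s + P) - alpha (s + P)).
    { apply (nondecr_of_derive_nonneg
         (fun s => L / 2 * phi s - c * mu * omega s - th s - alpha s)
         (fun s => (tau s * (L + c * (X s - mu)) - (1 + 2 * X s)) / rho s ^ 3));
        [| |exact HP0].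
      + clear s Eal Eom HP0 Hturn; intros s; auto_derive.
        * derive_side.
        * derive_values. specialize (Eta s).
          transitivity (L / 2 * f s - c * mu * (f s / 2 * (1 - X s / mu))
             - (1 + 2 * X s) / rho s ^ 3); [lra|].
          unfold f. specialize (Hr s); field; lra.
      + clear s Eal Eom HP0 Hturn; intros s.
        apply Rdiv_le_0_compat; [|apply pow_lt, Hr].
        assert (1 + 2 * X s <= tau s * (L + c * (X s - mu))); [|lra].
        apply HLc; [apply HX | apply Ht |].
        rewrite Htt, Hmm; unfold X; specialize (HB s); field; lra. }
    rewrite Eal, Eom, Hturn in W.
    assert (Hpi := PI_RGT_0). nra.
Qed.

(** * The frame of a spherical curve and the axis *)

Ltac vring := unfold killing, cross, dot, vadd, vsub, vscal, c1, c2, c3; simpl;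
  first [ring | f_equal; [f_equal; ring | ring]].

Lemma R3_ext (u v : R3) : c1 u = c1 v -> c2 u = c2 v -> c3 u = c3 v -> u = v.
Proof.
  destruct u as [[u1 u2] u3], v as [[v1 v2] v3]; unfold c1, c2, c3; simpl.
  now intros -> -> ->.
Qed.

Lemma enorm_sqr (u : R3) : enorm u ^ 2 = dot u u.
Proof.
  unfold enorm; simpl; rewrite Rmult_1_r; apply sqrt_sqrt.
  unfold dot; nra.
Qed.

Lemma enorm_eq (u : R3) (r : R) : 0 <= r -> (enorm u = r <-> dot u u = r ^ 2).
Proof.
  intros Hr; split; intros H.
  - now rewrite <- H, enorm_sqr.
  - unfold enorm; rewrite H; simpl; rewrite Rmult_1_r; now apply sqrt_square.
Qed.

Lemma dot_comm (u v : R3) : dot u v = dot v u.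
Proof. vring. Qed.

Lemma dot_vscal_l (a : R) (u v : R3) : dot (vscal a u) v = a * dot u v.
Proof. vring. Qed.

Lemma dot_vadd_l (u v w : R3) : dot (vadd u v) w = dot u w + dot v w.
Proof. vring. Qed.

Lemma dot_vadd_r (u v w : R3) : dot w (vadd u v) = dot w u + dot w v.
Proof. vring. Qed.

Lemma dot_vscal_r (a : R) (u v : R3) : dot v (vscal a u) = a * dot v u.
Proof. vring. Qed.

Lemma dot_cross_cross (u v y z : R3) :
  dot (cross u v) (cross y z) = dot u y * dot v z - dot u z * dot v y.
Proof. vring. Qed.

Lemma dot_cross_l (u v : R3) : dot (cross u v) u = 0.
Proof. vring. Qed.

Lemma dot_cross_r (u v : R3) : dot (cross u v) v = 0.
Proof. vring. Qed.

Definition orthonormal (e1 e2 : R3) : Prop :=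
  dot e1 e1 = 1 /\ dot e2 e2 = 1 /\ dot e1 e2 = 0.

Lemma orthonormal_expansion (e1 e2 y : R3) :
  orthonormal e1 e2 ->
  y = vadd (vadd (vscal (dot y e1) e1) (vscal (dot y e2) e2))
           (vscal (dot y (cross e1 e2)) (cross e1 e2)).
Proof.
  intros (H1 & H2 & H12).
  (* Cramer's rule, coordinate by coordinate, for [e1], [e2] and their cross product: a polynomial
     identity with the Gram determinant on the left, into which orthonormality is substituted
     afterwards. *)
  assert (G : forall c : R3 -> R, c = c1 \/ c = c2 \/ c = c3 ->
    c y * (dot e1 e1 * dot e2 e2 - dot e1 e2 * dot e1 e2) =
    dot y (cross e1 e2) * c (cross e1 e2)
    + dot y e2 * (c e2 * dot e1 e1 - c e1 * dot e1 e2)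
    - dot y e1 * (c e2 * dot e1 e2 - c e1 * dot e2 e2)).
  { intros c [->|[->| ->]]; vring. }
  rewrite H1, H2, H12 in G.
  apply R3_ext; [specialize (G c1) | specialize (G c2) | specialize (G c3)];
    (match type of G with _ -> ?A = _ => match A with ?c y * _ =>
      replace (c y) with (c y * (1 * 1 - 0 * 0)) by ring end end);
    rewrite G by tauto; unfold vadd, vscal; simpl; unfold c1, c2, c3; simpl; ring.
Qed.

Lemma orthonormal_ext (e1 e2 y z : R3) :
  orthonormal e1 e2 -> dot y e1 = dot z e1 -> dot y e2 = dot z e2 ->
  dot y (cross e1 e2) = dot z (cross e1 e2) -> y = z.
Proof.
  intros H A B C.
  rewrite (orthonormal_expansion e1 e2 y H), (orthonormal_expansion e1 e2 z H).
  now rewrite A, B, C.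
Qed.

Lemma orthonormal_parseval (e1 e2 y : R3) :
  orthonormal e1 e2 ->
  dot y y = dot y e1 ^ 2 + dot y e2 ^ 2 + dot y (cross e1 e2) ^ 2.
Proof.
  intros H.
  rewrite (orthonormal_expansion e1 e2 y H) at 2.
  rewrite !dot_vadd_r, !dot_vscal_r; ring.
Qed.

(** The strict inequality says that [y] is not parallel to [n], so [cross n y] can be normalised to
    [e1]; then [cross n e1] serves as [e2]. *)
Lemma orthonormal_completion (n y : R3) :
  dot n n = 1 -> dot y y = 1 -> dot n y ^ 2 < 1 ->
  exists e1 e2, orthonormal e1 e2 /\ cross e1 e2 = n.
Proof.
  intros Hn Hy Hny.
  set (d := sqrt (1 - dot n y ^ 2)).
  assert (Hd : 0 < d) by (apply sqrt_lt_R0; lra).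
  assert (Hdd : d * d = 1 - dot n y ^ 2) by (apply sqrt_sqrt; lra).
  set (e1 := vscal (/ d) (cross n y)).
  assert (H1 : dot e1 e1 = 1).
  { unfold e1; rewrite dot_vscal_l, dot_vscal_r, dot_cross_cross, Hn, Hy,
      (dot_comm y n).
    replace (1 * 1 - dot n y * dot n y) with (d * d) by (rewrite Hdd; ring).
    field; lra. }
  assert (H1n : dot e1 n = 0)
    by (unfold e1; rewrite dot_vscal_l, dot_cross_l; ring).
  exists e1, (cross n e1); split; [split; [exact H1|split]|].
  - rewrite dot_cross_cross, Hn, H1, H1n; ring.
  - rewrite dot_comm; apply dot_cross_r.
  - replace (cross e1 (cross n e1))
      with (vsub (vscal (dot e1 e1) n) (vscal (dot e1 n) e1))
      by (clearbody e1; destruct e1 as [[? ?] ?], n as [[? ?] ?]; vring).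
    rewrite H1, H1n. destruct n as [[? ?] ?]; vring.
Qed.

(** Unlike [vDerive], which inherits the default values of the total [Derive], this relation
    includes differentiability. *)
Definition is_vderive (u : R -> R3) (s : R) (l : R3) : Prop :=
  is_derive (fun t => c1 (u t)) s (c1 l) /\
  is_derive (fun t => c2 (u t)) s (c2 l) /\
  is_derive (fun t => c3 (u t)) s (c3 l).

Lemma is_derive_Rmult (f g : R -> R) (s f' g' : R) :
  is_derive f s f' -> is_derive g s g' ->
  is_derive (fun t => f t * g t) s (f' * g s + f s * g').
Proof.
  intros Hf Hg; apply (is_derive_mult f g); [exact Hf | exact Hg | apply Rmult_comm].
Qed.

Lemma is_derive_dot (u v : R -> R3) (s : R) (u' v' : R3) :
  is_vderive u s u' -> is_vderive v s v' ->
  is_derive (fun t => dot (u t) (v t)) s (dot u' (v s) + dot (u s) v').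
Proof.
  intros (U1 & U2 & U3) (V1 & V2 & V3).
  eapply is_derive_value.
  - apply @is_derive_plus; [apply @is_derive_plus|];
      apply is_derive_Rmult; eassumption.
  - unfold dot, plus; simpl; ring.
Qed.

Lemma is_vderive_cross (u v : R -> R3) (s : R) (u' v' : R3) :
  is_vderive u s u' -> is_vderive v s v' ->
  is_vderive (fun t => cross (u t) (v t)) s
    (vadd (cross u' (v s)) (cross (u s) v')).
Proof.
  intros (U1 & U2 & U3) (V1 & V2 & V3).
  split; [|split]; (eapply is_derive_value;
    [ apply @is_derive_minus; apply is_derive_Rmult; eassumption
    | unfold minus, plus, opp, cross, vadd; simpl; unfold c1, c2, c3; simpl; ring]).
Qed.

Lemma is_vderive_scal (f : R -> R) (u : R -> R3) (s f' : R) (u' : R3) :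
  is_derive f s f' -> is_vderive u s u' ->
  is_vderive (fun t => vscal (f t) (u t)) s
    (vadd (vscal f' (u s)) (vscal (f s) u')).
Proof.
  intros Hf (U1 & U2 & U3).
  split; [|split]; apply is_derive_Rmult; assumption.
Qed.

Lemma is_vderive_add (u v : R -> R3) (s : R) (u' v' : R3) :
  is_vderive u s u' -> is_vderive v s v' ->
  is_vderive (fun t => vadd (u t) (v t)) s (vadd u' v').
Proof.
  intros (U1 & U2 & U3) (V1 & V2 & V3).
  split; [|split]; apply @is_derive_plus; assumption.
Qed.

Lemma is_vderive_const (u : R3) (s : R) : is_vderive (fun _ => u) s (0, 0, 0).
Proof. split; [|split]; apply @is_derive_const. Qed.

Lemma is_vderive_value (u : R -> R3) (s : R) (l l' : R3) :
  is_vderive u s l -> l = l' -> is_vderive u s l'.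
Proof. intros H <-; exact H. Qed.

Lemma const_of_vderive_0 (u : R -> R3) :
  (forall s, is_vderive u s (0, 0, 0)) -> forall s t, u s = u t.
Proof.
  intros H s t; apply R3_ext;
    [ apply (const_of_derive_0 (fun s => c1 (u s)))
    | apply (const_of_derive_0 (fun s => c2 (u s)))
    | apply (const_of_derive_0 (fun s => c3 (u s)))];
    intros r; apply H.
Qed.

(** Orders 0 and 1 are convertible, component by component, with [x] and [tangent x]; order 2 is the
    derivative of the tangent. *)
Definition vDerive_n (x : R -> R3) (n : nat) (s : R) : R3 :=
  (Derive_n (fun t => c1 (x t)) n s,
   Derive_n (fun t => c2 (x t)) n s,
   Derive_n (fun t => c3 (x t)) n s).

Lemma vsmooth_derive (x : R -> R3) (n : nat) (s : R) :
  vsmooth x -> is_vderive (vDerive_n x n) s (vDerive_n x (S n) s).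
Proof.
  intros H; destruct (H (S n) s) as (H1 & H2 & H3).
  split; [|split]; apply Derive_correct; assumption.
Qed.

(** The Darboux equations [x' = T], [T' = kappa eps - x], [eps' = - kappa T]. Differentiating the
    constants [x.x], [x.T] and [T.T] determines the components of [T'] along [x] and [T]. *)
Lemma spherical_frame (x : R -> R3) :
  unit_speed_spherical x ->
  (forall s, is_vderive x s (tangent x s)) /\
  (forall s, orthonormal (x s) (tangent x s)) /\
  (forall s, geod_curv x s = dot (vDerive_n x 2 s) (conormal x s)) /\
  (forall s, is_vderive (tangent x) s
     (vadd (vscal (geod_curv x s) (conormal x s)) (vscal (-1) (x s)))) /\
  (forall s, is_vderive (conormal x) s
     (vscal (- geod_curv x s) (tangent x s))).
Proof.
  intros (Hsm & Hx & HT).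
  assert (Dx : forall s, is_vderive x s (tangent x s)).
  { intros s; exact (vsmooth_derive x 0 s Hsm). }
  assert (DT : forall s, is_vderive (tangent x) s (vDerive_n x 2 s)).
  { intros s; exact (vsmooth_derive x 1 s Hsm). }
  assert (Exx : forall s, dot (x s) (x s) = 1).
  { intros s; rewrite <- enorm_sqr, Hx; ring. }
  assert (ETT : forall s, dot (tangent x s) (tangent x s) = 1).
  { intros s; rewrite <- enorm_sqr, HT; ring. }
  assert (Const : forall (f : R -> R) (c s l : R), (forall t, f t = c) ->
            is_derive f s l -> l = 0).
  { intros f c s l Hf Hl. rewrite <- (is_derive_unique f s l Hl).
    rewrite (Derive_ext f (fun _ => c) s Hf). apply Derive_const. }
  assert (ExT : forall s, dot (x s) (tangent x s) = 0).
  { intros s.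
    assert (E := Const _ _ _ _ Exx (is_derive_dot x x s _ _ (Dx s) (Dx s))).
    rewrite (dot_comm (tangent x s)) in E; lra. }
  assert (E2x : forall s, dot (vDerive_n x 2 s) (x s) = -1).
  { intros s.
    assert (E := Const _ _ _ _ ExT (is_derive_dot x _ s _ _ (Dx s) (DT s))).
    rewrite ETT, (dot_comm (x s)) in E; lra. }
  assert (E2T : forall s, dot (vDerive_n x 2 s) (tangent x s) = 0).
  { intros s.
    assert (E := Const _ _ _ _ ETT (is_derive_dot _ _ s _ _ (DT s) (DT s))).
    rewrite (dot_comm (tangent x s)) in E; lra. }
  assert (O : forall s, orthonormal (x s) (tangent x s))
    by (intros s; repeat split; auto).
  assert (Ek : forall s, geod_curv x s = dot (vDerive_n x 2 s) (conormal x s)).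
  { intros s; unfold geod_curv, cov_tangent.
    change (vDerive (tangent x) s) with (vDerive_n x 2 s).
    rewrite E2x. replace (dot (vDerive_n x 2 s) (conormal x s))
      with (dot (vDerive_n x 2 s) (conormal x s)
            + dot (cross (x s) (tangent x s)) (x s))
      by (rewrite dot_cross_l; ring).
    unfold conormal; generalize (vDerive_n x 2 s) (tangent x s) (x s).
    intros; vring. }
  assert (E2 : forall s, vDerive_n x 2 s =
     vadd (vscal (geod_curv x s) (conormal x s)) (vscal (-1) (x s))).
  { intros s. rewrite (orthonormal_expansion _ _ (vDerive_n x 2 s) (O s)) at 1.
    rewrite E2x, E2T, Ek. fold (conormal x s). vring. }
  split; [exact Dx|]; split; [exact O|]; split; [exact Ek|]; split.
  - intros s; rewrite <- E2; apply DT.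
  - intros s; eapply is_vderive_value.
    + apply is_vderive_cross; [apply Dx | apply DT].
    + rewrite E2.
      replace (vscal (- geod_curv x s) (tangent x s)) with
        (vscal (geod_curv x s)
          (vsub (vscal (dot (x s) (tangent x s)) (x s))
                (vscal (dot (x s) (x s)) (tangent x s))))
        by (rewrite ExT, Exx; vring).
      unfold conormal; generalize (tangent x s) (x s) (geod_curv x s).
      intros; vring.
Qed.

(** * The curvature equation in terms of [rho], and the constant axis *)

Definition rho_of (x : R -> R3) (s : R) : R := Rpower (geod_curv x s) (- (1 / 3)).

Lemma Rpower_pow_INR (a y : R) (n : nat) : Rpower a y ^ n = Rpower a (y * INR n).
Proof.
  rewrite <- Rpower_pow by apply exp_pos. apply Rpower_mult.
Qed.

Lemma Bfun_rho (x : R -> R3) (s : R) : Bfun x s = rho_of x s ^ 2.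
Proof.
  unfold Bfun, rho_of; rewrite Rpower_pow_INR; f_equal; simpl; field.
Qed.

Lemma geod_curv_rho (x : R -> R3) (s : R) :
  0 < geod_curv x s -> geod_curv x s = / rho_of x s ^ 3.
Proof.
  intros H; unfold rho_of.
  rewrite Rpower_pow_INR, <- Rpower_Ropp.
  replace (- (- (1 / 3) * INR 3)) with 1 by (simpl; field).
  now rewrite Rpower_1.
Qed.

Lemma rho_of_pos (x : R -> R3) (s : R) : 0 < rho_of x s.
Proof. apply exp_pos. Qed.

(** The Euler-Lagrange equation is stated with total derivatives, so it yields a genuine derivative
    of [B'] only once differentiability is known. That comes from the smoothness of [x]: [B'] is
    explicit in [kappa] and [kappa'], hence in the derivatives of [x] up to order three. *)
Lemma rho_of_derive (x : R -> R3) :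
  eca_extremal x -> forall s,
  is_derive (rho_of x) s (Derive (Bfun x) s / (2 * rho_of x s)) /\
  is_derive (Derive (Bfun x)) s (2 / rho_of x s ^ 4 - rho_of x s ^ 2).
Proof.
  intros (Hsph & Hk & HEL).
  destruct (spherical_frame x Hsph) as (Dx & O & Ek & DT & De).
  assert (D2 := fun s => vsmooth_derive x 2 s (proj1 Hsph)).
  assert (D3 := fun s => vsmooth_derive x 3 s (proj1 Hsph)).
  set (k := geod_curv x) in *.
  set (k1 := fun s => dot (vDerive_n x 3 s) (conormal x s)
     + dot (vDerive_n x 2 s) (vscal (- k s) (tangent x s))).
  assert (Dk : forall s, is_derive k s (k1 s)).
  { intros s.
    apply (is_derive_ext (fun s => dot (vDerive_n x 2 s) (conormal x s))).
    - intros t; symmetry; apply Ek.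
    - apply is_derive_dot; [apply D2 | apply De]. }
  assert (Dk1 : forall s, ex_derive k1 s).
  { intros s; eexists.
    apply @is_derive_plus; apply is_derive_dot.
    - apply D3.
    - apply De.
    - apply D2.
    - apply is_vderive_scal; [|apply DT].
      apply (is_derive_opp k s (k1 s)), Dk. }
  set (r := rho_of x) in *.
  assert (Hr : forall s, 0 < r s) by apply rho_of_pos.
  assert (Dr : forall s, is_derive r s (- (1 / 3) * (k1 s / k s) * r s)).
  { intros s; unfold r, rho_of, Rpower. fold k. auto_derive.
    - derive_side. apply Hk.
    - derive_values. specialize (Hk s); field. fold k in Hk; lra. }
  assert (DB : forall s, is_derive (Bfun x) s (- (2 / 3) * (k1 s / k s) * r s ^ 2)).
  { intros s; apply (is_derive_ext (fun s => r s ^ 2)).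
    - intros t; symmetry; apply Bfun_rho.
    - auto_derive; [derive_side|]. derive_values. specialize (Hk s); fold k in Hk; field; lra. }
  assert (EB : forall s, Derive (Bfun x) s = - (2 / 3) * (k1 s / k s) * r s ^ 2)
    by (intros; apply is_derive_unique, DB).
  intros s; split.
  - eapply is_derive_value; [apply Dr|]. rewrite EB.
    specialize (Hr s); specialize (Hk s); fold k in Hk; field; lra.
  - assert (E : ex_derive (Derive (Bfun x)) s).
    { apply (ex_derive_ext (fun s => - (2 / 3) * (k1 s / k s) * r s ^ 2)).
      - intros t; symmetry; apply EB.
      - auto_derive; derive_side; [apply Dk1|].
        specialize (Hk s); fold k in Hk; lra. }
    apply Derive_correct in E.
    eapply is_derive_value; [exact E|].
    change (Derive (Derive (Bfun x)) s) with (Derive_n (Bfun x) 2 s).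
    specialize (HEL s); rewrite Bfun_rho in HEL; fold r in HEL.
    replace (2 / r s ^ 4) with (2 * / (r s ^ 2) ^ 2)
      by (specialize (Hr s); field; lra).
    lra.
Qed.

(** The identity [J = w x x] forces the components of [w] along [T] and [eps]; the component along
    [x] is then the one for which the [T] part of [w'] vanishes by the Euler-Lagrange equation. *)
Definition axis (x : R -> R3) (s : R) : R3 :=
  vadd (vadd (vscal (- rho_of x s ^ 2) (x s))
             (vscal (- Derive (Bfun x) s) (tangent x s)))
       (vscal (- 2 / rho_of x s) (conormal x s)).

(** In the derivative, the [x] components cancel because [B' = b], the [T] components by the
    equation for [b'], and the [eps] components because [(- 2 / rho)' = b / rho^3 = b kappa]. *)
Lemma axis_const (x : R -> R3) :
  eca_extremal x -> forall s t, axis x s = axis x t.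
Proof.
  intros Hx; assert (Dr := rho_of_derive x Hx).
  destruct Hx as (Hsph & Hk & HEL).
  destruct (spherical_frame x Hsph) as (Dx & O & Ek & DT & De).
  apply const_of_vderive_0; intros s.
  assert (Hr := rho_of_pos x).
  assert (Dr1 := fun s => proj1 (Dr s)). assert (Db := fun s => proj2 (Dr s)).
  eapply is_vderive_value.
  - apply is_vderive_add; [apply is_vderive_add|]; apply is_vderive_scal.
    + instantiate (1 := - Derive (Bfun x) s). auto_derive; [derive_side|].
      derive_values. specialize (Hr s); field; lra.
    + apply Dx.
    + apply (is_derive_opp (Derive (Bfun x)) s _ (Db s)).
    + apply DT.
    + instantiate (1 := Derive (Bfun x) s / rho_of x s ^ 3). auto_derive.
      * derive_side. specialize (Hr s); lra.
      * derive_values. specialize (Hr s); field; lra.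
    + apply De.
  - rewrite (geod_curv_rho x s (Hk s)). 
    specialize (Hr s).
    generalize (tangent x s) (conormal x s) (x s).
    intros; apply R3_ext; unfold opp; simpl;
    unfold vadd, vscal, c1, c2, c3; simpl; field; lra.
Qed.

Lemma axis_killing (x : R -> R3) :
  eca_extremal x -> forall s, Jfield x s = killing (axis x s) (x s).
Proof.
  intros (Hsph & Hk & HEL) s.
  destruct (spherical_frame x Hsph) as (_ & O & _ & _ & _).
  destruct (O s) as (Exx & ETT & ExT).
  unfold Jfield, axis.
  replace (Rpower (Bfun x s) (- (1 / 2))) with (/ rho_of x s).
  2:{ unfold Bfun, rho_of; rewrite Rpower_mult, <- Rpower_Ropp; f_equal; field. }
  transitivity (vadd (vscal (Derive (Bfun x) s) (conormal x s))
    (vscal (- 2 / rho_of x s)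
      (vsub (vscal (dot (x s) (x s)) (tangent x s))
            (vscal (dot (tangent x s) (x s)) (x s))))).
  - rewrite Exx, (dot_comm _ (x s)), ExT. unfold Rdiv.
    generalize (conormal x s) (tangent x s) (x s); intros; vring.
  - unfold conormal; generalize (tangent x s) (x s) (- 2 / rho_of x s).
    intros; vring.
Qed.

(** The squared length of the constant axis is the first integral; the other two products give the
    height of the curve and the numerator of its angular velocity. *)
Lemma axis_dot (x : R -> R3) :
  eca_extremal x -> forall s,
  dot (axis x s) (axis x s)
    = Derive (Bfun x) s ^ 2 + rho_of x s ^ 4 + 4 / rho_of x s ^ 2 /\
  dot (axis x s) (x s) = - rho_of x s ^ 2 /\
  dot (axis x s) (conormal x s) = - 2 / rho_of x s.
Proof.
  intros (Hsph & Hk & HEL) s.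
  destruct (spherical_frame x Hsph) as (_ & O & _ & _ & _).
  destruct (O s) as (Exx & ETT & ExT).
  assert (Eee : dot (conormal x s) (conormal x s) = 1)
    by (unfold conormal; rewrite dot_cross_cross, Exx, ETT, ExT; ring).
  assert (Exe : dot (x s) (conormal x s) = 0)
    by (rewrite dot_comm; apply dot_cross_l).
  assert (ETe : dot (tangent x s) (conormal x s) = 0)
    by (rewrite dot_comm; apply dot_cross_r).
  assert (Hr := rho_of_pos x s).
  unfold axis; rewrite !dot_vadd_l, !dot_vadd_r, !dot_vscal_l, !dot_vscal_r,
    ?(dot_comm (conormal x s) (x s)), ?(dot_comm (conormal x s) (tangent x s)),
    ?(dot_comm (tangent x s) (x s)), ?Exx, ?ETT, ?ExT, ?Eee, ?Exe, ?ETe.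
  repeat split; field; lra.
Qed.

Lemma extremal_cylindrical (x : R -> R3) :
  eca_extremal x ->
  exists (K : R) (e1 e2 : R3) (th : R -> R),
    profile K (rho_of x) (Derive (Bfun x)) /\
    orthonormal e1 e2 /\
    (forall s, Jfield x s = killing (vscal K (cross e1 e2)) (x s)) /\
    (forall s, is_derive th s
       (- (2 * K / (rho_of x s * (K ^ 2 - rho_of x s ^ 4))))) /\
    forall s, let r := sqrt (1 - (rho_of x s ^ 2 / K) ^ 2) in
      0 < r /\
      dot (x s) e1 = r * cos (th s) /\ dot (x s) e2 = r * sin (th s) /\
      dot (x s) (cross e1 e2) = - rho_of x s ^ 2 / K.
Proof.
  intros Hx.
  assert (Hdr := rho_of_derive x Hx).
  assert (HJ := axis_killing x Hx). assert (Hd := axis_dot x Hx).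
  assert (Hc := axis_const x Hx).
  destruct Hx as (Hsph & Hk & HEL).
  destruct (spherical_frame x Hsph) as (Dx & O & _ & _ & _).
  assert (Hr := rho_of_pos x).
  set (rho := rho_of x) in *. set (b := Derive (Bfun x)) in *.
  set (w := axis x 0).
  assert (Ew : forall s, axis x s = w) by (intros; apply Hc).
  set (K := enorm w).
  assert (EK : forall s, K ^ 2 = b s ^ 2 + rho s ^ 4 + 4 / rho s ^ 2).
  { intros s; unfold K; rewrite enorm_sqr, <- (Ew s). apply Hd. }
  assert (HK : 0 < K).
  { assert (0 <= K) by apply sqrt_pos.
    assert (0 < K ^ 2); [|nra].
    rewrite (EK 0); specialize (Hr 0).
    assert (0 < 4 / rho 0 ^ 2) by (apply Rdiv_lt_0_compat; nra).
    assert (0 < rho 0 ^ 4) by (apply pow_lt; lra). nra. }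
  assert (HP : profile K rho b).
  { repeat split; try apply Hdr; auto. intros s; rewrite (EK s); ring. }
  assert (HB := profile_lt _ _ _ HP).
  assert (Hz : forall s, 0 < 1 - (rho s ^ 2 / K) ^ 2).
  { intros s; specialize (HB s).
    replace (1 - (rho s ^ 2 / K) ^ 2)
      with ((K - rho s ^ 2) * (K + rho s ^ 2) / (K * K)) by (field; lra).
    apply Rdiv_lt_0_compat; nra. }
  set (n := vscal (/ K) w).
  assert (Hn : dot n n = 1).
  { unfold n; rewrite dot_vscal_l, dot_vscal_r, <- enorm_sqr; fold K.
    field; lra. }
  assert (Enx : forall s, dot (x s) n = - rho s ^ 2 / K).
  { intros s; unfold n; rewrite dot_vscal_r, dot_comm, <- (Ew s).
    rewrite (proj1 (proj2 (Hd s))); field; lra. }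
  assert (Ene : forall s, dot (conormal x s) n = - 2 / (rho s * K)).
  { intros s; unfold n; rewrite dot_vscal_r, dot_comm, <- (Ew s).
    rewrite (proj2 (proj2 (Hd s))); specialize (Hr s); field; lra. }
  destruct (orthonormal_completion n (x 0)) as (e1 & e2 & He & En).
  { exact Hn. }
  { apply O. }
  { rewrite dot_comm, Enx. specialize (Hz 0).
    replace ((- rho 0 ^ 2 / K) ^ 2) with ((rho 0 ^ 2 / K) ^ 2) by (field; lra).
    lra. }
  assert (Hsum : forall s, dot (x s) e1 * dot (x s) e1 + dot (x s) e2 * dot (x s) e2
                  = 1 - (rho s ^ 2 / K) ^ 2).
  { intros s; assert (Pv := orthonormal_parseval e1 e2 (x s) He).
    rewrite En, Enx, (proj1 (O s)) in Pv.
    replace ((- rho s ^ 2 / K) ^ 2) with ((rho s ^ 2 / K) ^ 2) in Pv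
      by (field; lra).
    lra. }
  assert (Dxe : forall e s, is_derive (fun s => dot (x s) e) s (dot (tangent x s) e)).
  { intros e s; eapply is_derive_value.
    - apply (is_derive_dot x (fun _ => e)); [apply Dx | apply is_vderive_const].
    - unfold dot at 2; simpl; unfold c1, c2, c3; simpl; ring. }
  destruct (angle_lift (fun s => dot (x s) e1) (fun s => dot (x s) e2)
     (fun s => dot (tangent x s) e1) (fun s => dot (tangent x s) e2)
     (fun s => - (2 * K / (rho s * (K ^ 2 - rho s ^ 4))))) as (th & Dth & Eth).
  - apply Dxe.
  - apply Dxe.
  - intros s; apply (ex_derive_continuous
      (fun s => - (2 * K / (rho s * (K ^ 2 - rho s ^ 4))))).
    assert (Dr := fun s => proj1 (Hdr s)).
    specialize (HB s).
    assert (0 < rho s * (K ^ 2 - rho s ^ 4))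
      by (apply Rmult_lt_0_compat; [apply Hr | nra]).
    auto_derive; derive_side. simpl in *; lra.
  - intros s; rewrite Hsum; apply Hz.
  - intros s; rewrite Hsum.
    (* By the Binet-Cauchy identity, the planar determinant of [x] and [T] is the component of [eps]
       along the axis. *)
    replace (dot (x s) e1 * dot (tangent x s) e2 - dot (x s) e2 * dot (tangent x s) e1)
      with (dot (conormal x s) (cross e1 e2))
      by (unfold conormal; rewrite dot_cross_cross; ring).
    rewrite En, Ene. specialize (HB s); specialize (Hr s).
    assert (0 < K ^ 2 - rho s ^ 4) by nra. field. lra.
  - exists K, e1, e2, th.
    split; [exact HP|]; split; [exact He|]; split; [|split; [exact Dth|]].
    + intros s; rewrite HJ, Ew, En; f_equal.
      unfold n; generalize w; intros v; clear - HK.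
      apply R3_ext; unfold vscal, c1, c2, c3; simpl; field; lra.
    + intros s; specialize (Eth s); rewrite Hsum in Eth.
      split; [apply sqrt_lt_R0, Hz|]; split; [apply Eth|]; split; [apply Eth|].
      rewrite En; apply Enx.
Qed.

(** * Closed extremals *)

(** Here [B^3 = 2] and [K^2 = 3 B^2], so the height [z] satisfies [z^2 = 1 / 3] and the radius
    squared is [2 / 3]. That the whole circle is covered follows from the angle being affine in [s]
    with nonzero slope. *)
Lemma circle_of_constant_curvature (x : R -> R3) :
  eca_extremal x -> (forall s, Derive (Bfun x) s = 0) ->
  planar_circle x (sqrt 6 / 3).
Proof.
  intros Hx Hb.
  destruct (extremal_cylindrical x Hx) as (K & e1 & e2 & th & HP & He & _ & Dth & Hcyl).
  assert (HB := profile_lt _ _ _ HP).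
  destruct HP as (HK & Hr & Hdr & Hdb & HE).
  set (rho := rho_of x) in *.
  set (p := rho 0).
  assert (Hp : forall s, rho s = p).
  { intros s; apply const_of_derive_0; clear s; intros s.
    eapply is_derive_value; [apply Hdr|]. rewrite Hb; unfold Rdiv; ring. }
  assert (Hpp : 0 < p) by apply Hr.
  assert (Ep : (p ^ 2) ^ 3 = 2).
  { assert (E : 2 / p ^ 4 - p ^ 2 = 0).
    { rewrite <- (Hp 0), <- (is_derive_unique _ _ _ (Hdb 0)).
      rewrite (Derive_ext _ (fun _ => 0) 0 Hb). apply Derive_const. }
    replace ((p ^ 2) ^ 3) with (2 - p ^ 4 * (2 / p ^ 4 - p ^ 2)) by (field; lra).
    rewrite E; ring. }
  assert (EK : K ^ 2 = 3 * (p ^ 2) ^ 2).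
  { specialize (HE 0); rewrite Hb, Hp in HE.
    replace (4 / p ^ 2) with (2 * (p ^ 2) ^ 2) in HE
      by (rewrite <- (Rmult_1_r 4);
          replace (4 * 1) with (2 * (p ^ 2) ^ 3) by (rewrite Ep; ring);
          field; lra).
    replace (p ^ 4) with ((p ^ 2) ^ 2) in HE by ring. lra. }
  set (z := - p ^ 2 / K).
  assert (Ez : z ^ 2 = 1 / 3).
  { unfold z; replace ((- p ^ 2 / K) ^ 2) with ((p ^ 2) ^ 2 / K ^ 2)
      by (field; lra).
    rewrite EK; field; lra. }
  set (R0 := sqrt 6 / 3).
  assert (HR0 : 0 < R0)
    by (apply Rdiv_lt_0_compat; [apply sqrt_lt_R0; lra | lra]).
  assert (ER0 : R0 ^ 2 = 2 / 3).
  { unfold R0; replace ((sqrt 6 / 3) ^ 2) with (sqrt 6 * sqrt 6 / 9) by field.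
    rewrite sqrt_sqrt by lra; field. }
  assert (Cyl : forall s, dot (x s) e1 = R0 * cos (th s) /\
      dot (x s) e2 = R0 * sin (th s) /\ dot (x s) (cross e1 e2) = z).
  { intros s; specialize (Hcyl s); cbv zeta in Hcyl; rewrite Hp in Hcyl.
    replace (sqrt (1 - (p ^ 2 / K) ^ 2)) with R0 in Hcyl; [apply Hcyl|].
    replace ((p ^ 2 / K) ^ 2) with (z ^ 2) by (unfold z; field; lra).
    rewrite Ez; replace (1 - 1 / 3) with (R0 * R0) by (simpl in ER0; lra).
    symmetry; apply sqrt_square; lra. }
  set (n := cross e1 e2).
  assert (Hn : dot n n = 1).
  { destruct He as (H1 & H2 & H12).
    unfold n; rewrite dot_cross_cross, H1, H2, H12; ring. }
  assert (Hx1 : forall s, dot (x s) (x s) = 1).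
  { intros s; apply (spherical_frame x (proj1 Hx)). }
  assert (Sub : forall u y, dot u (vsub y (vscal z n)) = dot u y - z * dot u n)
    by (intros; clear; vring).
  assert (Sub2 : forall y, dot (vsub y (vscal z n)) (vsub y (vscal z n))
            = dot y y - 2 * z * dot y n + z ^ 2 * dot n n)
    by (intros; clear; vring).
  exists (vscal z n), n; split; [apply enorm_eq; lra|]. intros y; split.
  - intros [s <-]. destruct (Cyl s) as (_ & _ & Ec). fold n in Ec. split.
    + rewrite Sub, dot_comm, Ec, Hn; ring.
    + apply enorm_eq; [lra|]. rewrite Sub2, Ec, Hx1, Hn. fold R0.
      rewrite ER0; simpl in *; lra.
  - intros [H1 H2].
    rewrite Sub, dot_comm, Hn in H1.
    apply enorm_eq in H2; [|lra]. rewrite Sub2, Hn in H2. fold R0 in H2.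
    assert (Hyn : dot y n = z) by lra.
    rewrite Hyn in H2.
    assert (Pv := orthonormal_parseval e1 e2 y He). fold n in Pv.
    rewrite Hyn in Pv.
    destruct (polar_angle (dot y e1 / R0) (dot y e2 / R0)) as (t & C & S).
    { replace (dot y e1 / R0 * (dot y e1 / R0) + dot y e2 / R0 * (dot y e2 / R0))
        with ((dot y e1 ^ 2 + dot y e2 ^ 2) / R0 ^ 2) by (field; lra).
      replace (dot y e1 ^ 2 + dot y e2 ^ 2) with (R0 ^ 2)
        by (simpl in *; lra).
      field; lra. }
    set (c := - (2 * K / (p * (K ^ 2 - p ^ 4)))).
    assert (Hc : c <> 0).
    { specialize (HB 0); rewrite Hp in HB.
      assert (0 < K ^ 2 - p ^ 4) by nra.
      assert (0 < 2 * K / (p * (K ^ 2 - p ^ 4)))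
        by (apply Rdiv_lt_0_compat; [lra | apply Rmult_lt_0_compat; lra]).
      unfold c; lra. }
    assert (Lin : forall s, th s = th 0 + c * s).
    { intros s.
      assert (E := same_derive_diff th (fun s => c * s) (fun _ => c)).
      specialize (E ltac:(intros u; eapply is_derive_value;
                         [apply Dth | now rewrite Hp])).
      specialize (E ltac:(intros u; auto_derive; [trivial | ring]) s 0). lra. }
    exists ((t - th 0) / c).
    assert (Et : th ((t - th 0) / c) = t) by (rewrite Lin; field; exact Hc).
    destruct (Cyl ((t - th 0) / c)) as (C1 & C2 & C3). rewrite Et in *.
    apply (orthonormal_ext e1 e2 _ _ He).
    + rewrite C1, <- C; field; lra.
    + rewrite C2, <- S; field; lra.
    + rewrite C3; symmetry; exact Hyn.
Qed.

(** * Counting periods of the curvature and turns about the axis *)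

Lemma least_period_iff (f g : R -> R) (P : R) :
  (forall Q, (forall s, f (s + Q) = f s) <-> (forall s, g (s + Q) = g s)) ->
  least_period f P -> least_period g P.
Proof.
  intros H (H0 & H1 & H2); split; [exact H0|]; split.
  - apply H, H1.
  - intros Q HQ HgQ; apply H2; [exact HQ | apply H, HgQ].
Qed.

Lemma constant_increment (th f : R -> R) (P : R) :
  (forall s, is_derive th s (f s)) -> (forall s, f (s + P) = f s) ->
  forall s, th (s + P) - th s = th (0 + P) - th 0.
Proof.
  intros H HP s.
  apply (same_derive_diff (fun s => th (s + P)) th f); [|exact H].
  intros t; apply is_derive_shift; rewrite <- HP; apply H.
Qed.

Lemma multiple_increment (th : R -> R) (P d : R) (n : nat) :
  (forall s, th (s + P) - th s = d) ->
  forall s, th (s + INR n * P) = th s + INR n * d.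
Proof.
  intros H; induction n as [|n IH]; intros s.
  - simpl; rewrite !Rmult_0_l, !Rplus_0_r; reflexivity.
  - rewrite S_INR.
    replace (s + (INR n + 1) * P) with (s + INR n * P + P) by ring.
    specialize (IH s); specialize (H (s + INR n * P)); lra.
Qed.

Lemma reduce_fraction (a b : nat) :
  (0 < a)%nat -> (0 < b)%nat ->
  exists g p q : nat, (0 < g)%nat /\ (0 < p)%nat /\ (0 < q)%nat /\
    Nat.gcd p q = 1%nat /\ (a = g * p)%nat /\ (b = g * q)%nat.
Proof.
  intros Ha Hb. exists (Nat.gcd a b).
  destruct (Nat.gcd_divide_l a b) as [p Hp].
  destruct (Nat.gcd_divide_r a b) as [q Hq].
  exists p, q.
  assert (Hg : Nat.gcd a b <> 0%nat) by (intros E; rewrite E in Hp; lia).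
  repeat split; try lia.
  replace p with (a / Nat.gcd a b)%nat
    by (rewrite Hp at 1; apply Nat.div_mul; exact Hg).
  replace q with (b / Nat.gcd a b)%nat
    by (rewrite Hq at 1; apply Nat.div_mul; exact Hg).
  apply Nat.gcd_div_gcd; trivial.
Qed.

Theorem theorem1p5 :
  forall x : R -> R3,
    eca_extremal x ->
    closed_curve x ->
    planar_circle x (sqrt 6 / 3)
    \/
    (~ constant_fun (geod_curv x) /\
     exists p q : nat,
       (0 < p)%nat /\ (0 < q)%nat /\ Nat.gcd p q = 1%nat /\
       closes_up x p q /\
       1 / 2 < INR p / INR q < sqrt 2 / 2).
Proof.
  intros x Hx (L & HL & HxL).
  destruct (classic (forall s, Derive (Bfun x) s = 0)) as [Hb|Hb].
  { left; now apply circle_of_constant_curvature. }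
  right. apply not_all_ex_not in Hb.
  destruct (extremal_cylindrical x Hx) as (K & e1 & e2 & th & HP & He & HJ & Dth & Hcyl).
  destruct (profile_progression K _ _ HP Hb) as (P & HPrho & Hprog).
  assert (HK := proj1 HP). assert (Hr := rho_of_pos x).
  assert (Hrp := proj1 (proj2 HPrho)). assert (HP0 := proj1 HPrho).
  assert (HPk : least_period (geod_curv x) P).
  { refine (least_period_iff _ _ P _ HPrho). intros Q; split; intros H s.
    - rewrite !geod_curv_rho by apply Hx. now rewrite H.
    - unfold rho_of. now rewrite H. }
  (* The azimuth decreases along the curve, hence the sign. *)
  set (Lam := - (th (0 + P) - th 0)).
  assert (Hinc : forall s, th (s + P) - th s = - Lam).
  { intros s; unfold Lam; rewrite Ropp_involutive.
    apply (constant_increment th _ P Dth). intros t; cbv beta; now rewrite Hrp. }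
  assert (HLam : PI < Lam < PI * sqrt 2).
  { replace Lam with (- th (0 + P) - - th 0) by (unfold Lam; ring).
    apply (Hprog (fun s => - th s)). intros s.
    eapply is_derive_value; [apply (is_derive_opp th s _ (Dth s))|].
    unfold opp; simpl; ring. }
  assert (Hpi := PI_RGT_0).
  (* The height [- rho^2 / K] depends only on the position, so any period of the curve is one of
     [rho]. *)
  assert (HrL : forall s, rho_of x (s + L) = rho_of x s).
  { intros s.
    destruct (Hcyl s) as (_ & _ & _ & E1).
    destruct (Hcyl (s + L)) as (_ & _ & _ & E2).
    rewrite HxL, E1 in E2.
    apply (Rmult_eq_reg_r (/ K)) in E2; [|apply Rinv_neq_0_compat; lra].
    generalize (Hr s) (Hr (s + L)); nra. }
  destruct (least_period_divides _ P L HPrho HL HrL) as (q0 & Hq0 & EL).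
  destruct (cos_sin_eq (th 0) (th (0 + L))) as [k Hk].
  { destruct (Hcyl 0) as (R0 & E1 & _). destruct (Hcyl (0 + L)) as (_ & E2 & _).
    rewrite HxL, HrL in E2. rewrite E1 in E2.
    apply Rmult_eq_reg_l in E2; [exact E2 | lra]. }
  { destruct (Hcyl 0) as (R0 & _ & E1 & _). destruct (Hcyl (0 + L)) as (_ & _ & E2 & _).
    rewrite HxL, HrL in E2. rewrite E1 in E2.
    apply Rmult_eq_reg_l in E2; [exact E2 | lra]. }
  assert (Hturn : INR q0 * Lam = 2 * PI * IZR (- k)).
  { generalize (multiple_increment th P (- Lam) q0 Hinc 0).
    rewrite <- EL, opp_IZR; lra. }
  assert (Hq0r : 0 < INR q0) by now apply lt_0_INR.
  assert (Hkpos : (0 < - k)%Z).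
  { apply lt_IZR. assert (0 < INR q0 * Lam) by (apply Rmult_lt_0_compat; lra). nra. }
  (* The given [L] may run through the curve several times; [g] is this common factor of the turns
     and the curvature periods. *)
  destruct (reduce_fraction (Z.to_nat (- k)) q0) as
    (g & p & q & Hg & Hp & Hq & Hgcd & Ep & Eq); [lia | exact Hq0 |].
  assert (Hpq : INR q * Lam = 2 * PI * INR p).
  { apply lt_0_INR in Hg.
    apply (Rmult_eq_reg_l (INR g)); [|lra].
    rewrite <- (Z2Nat.id (- k)), <- INR_IZR_INZ, Ep, Eq, !mult_INR in Hturn by lia.
    lra. }
  assert (Hqr : 0 < INR q) by now apply lt_0_INR.
  split.
  (* A constant function would also have the period [P / 2], against minimality. *)
  { intros [c Hc]. destruct HPk as (_ & _ & Hmin).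
    assert (P <= P / 2); [|lra].
    apply Hmin; [lra|]; intros s; now rewrite !Hc. }
  exists p, q; split; [exact Hp|]; split; [exact Hq|]; split; [exact Hgcd|]; split.
  - exists P, Lam; split; [exact HPk|]; split; [|split; [exact Hpq|]].
    + assert (Ew : enorm (vscal K (cross e1 e2)) = K).
      { apply enorm_eq; [lra|]. destruct He as (H1 & H2 & H12).
        rewrite dot_vscal_l, dot_vscal_r, dot_cross_cross, H1, H2, H12; ring. }
      exists (vscal K (cross e1 e2)), th.
      split; [rewrite Ew; lra|]; split; [exact HJ|]; split.
      * split.
        { intros s; apply (ex_derive_continuous th); eexists; apply Dth. }
        destruct He as (H1 & H2 & H12).
        exists e1, e2, (fun s => sqrt (1 - (rho_of x s ^ 2 / K) ^ 2)).
        split; [apply enorm_eq; lra|]; split; [apply enorm_eq; lra|].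
        split; [exact H12|]; split; [now rewrite Ew|].
        intros s; destruct (Hcyl s) as (A & B & C & _); auto.
      * intros s; rewrite Hinc, Rabs_Ropp, Rabs_right; lra.
    (* After [q] periods the height and radius recur and the azimuth has changed by [- p] full
       turns, so all three coordinates agree. *)
    + intros s. apply (orthonormal_ext e1 e2 _ _ He);
        destruct (Hcyl s) as (_ & A & B & C);
        destruct (Hcyl (s + INR q * P)) as (_ & A' & B' & C');
        rewrite (periodic_mult _ P q Hrp) in A', B', C';
        rewrite (multiple_increment th P (- Lam) q Hinc) in A', B';
        replace (th s + INR q * - Lam) with (th s + 2 * PI * IZR (- Z.of_nat p))
          in A', B' by (rewrite opp_IZR, <- INR_IZR_INZ; lra);
        destruct (cos_sin_shift (th s) (- Z.of_nat p)) as [E1 E2];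
        rewrite E1 in A'; rewrite E2 in B'.
      * now rewrite A, A'.
      * now rewrite B, B'.
      * now rewrite C, C'.
  - replace (INR p / INR q) with (Lam / (2 * PI)).
    + split.
      * apply Rmult_lt_reg_r with (2 * PI); [lra|].
        replace (Lam / (2 * PI) * (2 * PI)) with Lam by (field; lra). lra.
      * apply Rmult_lt_reg_r with (2 * PI); [lra|].
        replace (Lam / (2 * PI) * (2 * PI)) with Lam by (field; lra). lra.
    + apply (Rmult_eq_reg_r (INR q * (2 * PI))); [|apply Rgt_not_eq; nra].
      transitivity (INR q * Lam); [field; lra|].
      rewrite Hpq; field; lra.
Qed.
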